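(* Let $d\ge1$, $a>0$, $p\in(0,1)$, and let $\mu\in\mathcal{P}(\mathbb{R}^d)$ satisfy $E:=\int_{\mathbb{R}^d}e^{b|y|^p}\,d\mu(y)<\infty$ for some $b>2^{p+1}a$. (a) Suppose that $b>2^{p+2}a$ if $p\ge d/2$, and $b>2^{p+1}da/(d-p)$ if $p\in(0,d/2)$. Then there is a constant $C>0$ depending only on $d,p,a,b,E$ such that for all integers $N\ge1$, $$\mathbb{E}[\mathcal{E}_{p,a}(\mu,\mu_N)]\le C\begin{cases}N^{-1/2}&\text{if }p>d/2,\\ \log(N+1)N^{-1/2}&\text{if }p=d/2,\\ N^{-p/d}&\text{if }p\in(0,d/2).\end{cases}$$ (b) Suppose that $b\in(2^{p+1}a,2^{p+2}a]$ if $p\ge d/2$, and $b\in(2^{p+1}a,2^{p+1}da/(d-p)]$ if $p\in(0,d/2)$. Then for every $\varepsilon\in(0,1-2^{p+1}a/b)$ there is a constant $C>0$ depending only on $d,p,a,b,E,\varepsilon$ such that for all integers $N\ge1$, $$\mathbb{E}[\mathcal{E}_{p,a}(\mu,\mu_N)]\le CN^{-(1-2^{p+1}a/b-\varepsilon)}.$$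
   Context: $\mathcal{P}(\mathbb{R}^d)$ is the set of Borel probability measures on $\mathbb{R}^d$; $|\cdot|$ is the Euclidean norm. $X_1,X_2,\dots$ are i.i.d. with law $\mu$ on a probability space $(\Omega,\mathbb{P})$ with expectation $\mathbb{E}$, and $\mu_N=\frac1N\sum_{i=1}^N\delta_{X_i}$. $\mathcal{E}_{p,a}(\mu,\nu):=\inf_{\pi\in\mathrm{Cpl}(\mu,\nu)}\int_{\mathbb{R}^d\times\mathbb{R}^d}\big(e^{a|x-y|^p}-1\big)\,d\pi(x,y)$, where $\mathrm{Cpl}(\mu,\nu)$ is the set of couplings of $\mu$ and $\nu$. *)

(* Defs.v *)
From HB Require Import structures.
From mathcomp Require Import all_boot all_order all_algebra finmap.
From mathcomp Require Import all_classical all_reals all_analysis.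

Set Implicit Arguments.
Unset Strict Implicit.
Unset Printing Implicit Defensive.

Import Order.TTheory GRing.Theory Num.Theory.
Import numFieldNormedType.Exports.

Local Open Scope classical_set_scope.
Local Open Scope ring_scope.

(* R^d with its Borel sigma-algebra.  The library topology on row vectors comes
   from the sup norm; its open sets are those of the Euclidean norm. *)
Notation borelRd R d := (g_sigma_algebraType (@open 'rV[R]_d)).

(* The norm `|x| of the library on row vectors is the sup norm. *)
Definition enorm (R : realType) (d : nat) (x : 'rV[R]_d) : R :=
  Num.sqrt (\sum_(i < d) x ord0 i ^+ 2).

Definition exp_cost (R : realType) (d : nat) (p a : R) (x y : 'rV[R]_d) : R :=
  expR (a * enorm (x - y) `^ p) - 1.

Definition couplings (R : realType) (d : nat)
    (mu nu : {measure set (borelRd R d) -> \bar R}) :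
    set (probability (borelRd R d * borelRd R d)%type R) :=
  [set pi | forall A : set (borelRd R d), measurable A ->
     pushforward pi fst A = mu A /\ pushforward pi snd A = nu A].

Definition transport_cost (R : realType) (d : nat) (p a : R)
    (mu nu : {measure set (borelRd R d) -> \bar R}) : \bar R :=
  ereal_inf [set (\int[pi]_z (exp_cost p a z.1 z.2)%:E)%E
            | pi in couplings mu nu].

(* Samples are indexed from 0: mu_N uses X 0, ..., X N.-1. *)
Definition empirical_measure (R : realType) (d : nat) (Omega : Type)
    (X : nat -> Omega -> borelRd R d) (N : nat) (w : Omega) :
    {measure set (borelRd R d) -> \bar R} :=
  mscale (N%:R^-1)%:nng (msum (fun i => \d_(X i w)) N).

Definition mutually_independent (R : realType)
    (dO dT : measure_display) (Omega : measurableType dO)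
    (T : measurableType dT) (P : probability Omega R)
    (X : nat -> {RV P >-> T}) : Prop :=
  forall (J : {fset nat}) (A : nat -> set T),
    (forall i, i \in J -> measurable (A i)) ->
    P (\bigcap_(i in [set` J]) (X i @^-1` A i)) =
    (\prod_(i <- J) P (X i @^-1` A i))%E.

Definition iid_with_law (R : realType)
    (dO dT : measure_display) (Omega : measurableType dO)
    (T : measurableType dT) (P : probability Omega R)
    (X : nat -> {RV P >-> T}) (mu : probability T R) : Prop :=
  mutually_independent X /\
  (forall i (A : set T), measurable A -> distribution P (X i) A = mu A).

Definition rate (R : realType) (d : nat) (p : R) (N : nat) : R :=
  if d%:R / 2 < p then N%:R `^ (- 2^-1)
  else if p == d%:R / 2 then ln (N%:R + 1) * N%:R `^ (- 2^-1)
  else N%:R `^ (- (p / d%:R)).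

(* Main.v *)
Require Import Defs.
From mathcomp Require Import all_boot all_order all_algebra finmap.
From mathcomp Require Import all_classical all_reals all_analysis.
From mathcomp Require Import measurable_realfun ring lra.
Import Order.TTheory GRing.Theory Num.Theory.
Import numFieldNormedType.Exports.
Local Open Scope classical_set_scope.
Local Open Scope ring_scope.

(** Cut R^d into dyadic annuli {|x| ~ 2^n}, and cut the n-th annulus into cubes of side
2^(n-l) for l = 0, ..., L.  Matching as much mass as possible of mu and mu_N inside the
smallest cubes, then matching what is left inside the next larger ones, and so on, gives a
coupling in which the mass transported inside the cells of scale l is controlled by the
deviations |mu(F) - mu_N(F)| of the cells F of scale l + 1; what survives all scales is
moved between annuli.  Transport inside the annulus n at scale l costs at most a constant
times 2^(-pl) w_n with w_n = (1 + 2^(np)) exp(2 a 2^(np)).  The deviations of all the cells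
of scale l in the annulus n add up in mean to at most 2 min(t_n, sqrt(2^(dl) t_n / N)), up
to constants, where t_n = mu(annulus n) <= E exp(-b 2^((n-1)p)), hence to at most
t_n^(1-th) (2^(dl) / N)^th for every th in [0, 1/2].  The sum over n of w_n t_n^(1-th)
converges when th < 1 - 2^(p+1) a / b, and it remains to choose th and to take 2^(dL) of
order N. *)

(** * Multiscale matching on a finite set *)

(** The quantity 2^(p+1) a / b arises as follows. Since p < 1, two points of norm at most c satisfy
    a |x - y|^p <= 2 a c^p, while the mass of annulus n is controlled only at its inner radius,
    whose p-th power is smaller by 2^p; so w_n t_n^(1-th) decays exactly when b (1 - th) / 2^p > 2
    a. The deviations at scale l then contribute N^(-th) 2^((d th - p) l) up to constants, and the
    sum over scales is critical at th = p/d. The case distinctions of the theorem tell which th are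
    admissible: th = 1/2 requires b > 2^(p+2) a, and th = p/d requires b > 2^(p+1) d a / (d - p). In
    (a) one takes th = 1/2 if p >= d/2 and some th strictly above p/d otherwise; in (b), th = 1 -
    2^(p+1) a / b - eps lies below p/d. To have finitely many cells, the annuli are cut off at an
    index M chosen after N, and the region beyond is paid for by the spare exponential moment. All
    sums over annuli are bounded uniformly in M, and mu enters the constants only through E. *)

Definition cell_mass {R : realFieldType} {S : finType} (r : S -> S)
    (m : S -> R) (k : S) : R := \sum_(s | r s == k) m s.

Lemma cell_mass_ge0 {R : realFieldType} {S : finType} (r : S -> S) (m : S -> R) k :
  (forall s, 0 <= m s) -> 0 <= cell_mass r m k.
Proof. by move=> m0; apply: sumr_ge0. Qed.

Lemma le_cell_mass {R : realFieldType} {S : finType} (r : S -> S) (m : S -> R) s :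
  (forall s, 0 <= m s) -> m s <= cell_mass r m (r s).
Proof.
move=> m0; rewrite /cell_mass (bigD1 s)//= lerDl.
by apply: sumr_ge0.
Qed.

Lemma cell_mass_coarsen {R : realFieldType} {S : finType} (r f : S -> S) (m : S -> R) k :
  cell_mass (f \o r) m k = \sum_(j | f j == k) cell_mass r m j.
Proof.
rewrite /cell_mass (partition_big r (fun j => f j == k))//=.
apply: eq_bigr => j /eqP <-; apply: eq_bigl => s.
by case: (r s =P j) => [->|]; rewrite ?eqxx ?andbF.
Qed.

Lemma sum_cell_mass {R : realFieldType} {S : finType} (r : S -> S) (m g : S -> R) :
  \sum_s g (r s) * m s = \sum_k g k * cell_mass r m k.
Proof.
rewrite (partition_big r predT)//=; apply: eq_bigr => k _.
by rewrite mulr_sumr; apply: eq_bigr => s /eqP ->.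
Qed.

(** A rescaled product inside each cell. Dividing by the larger of the two cell masses keeps both
    marginals below [m] and [n] and uses up the lighter side. If both masses vanish, the quotient
    takes its default value 0. *)
Definition cell_match {R : realFieldType} {S : finType} (r : S -> S)
    (m n : S -> R) (s t : S) : R :=
  if r s == r t then
    m s * n t / Num.max (cell_mass r m (r s)) (cell_mass r n (r s))
  else 0.

Section cell_match.
Context {R : realFieldType} {S : finType} (r : S -> S) (m n : S -> R).
Hypotheses (m0 : forall s, 0 <= m s) (n0 : forall s, 0 <= n s).

Let M := cell_mass r m.
Let N := cell_mass r n.

Lemma cell_match_ge0 s t : 0 <= cell_match r m n s t.
Proof.
rewrite /cell_match; case: ifP => // _; rewrite divr_ge0 ?mulr_ge0//.
by rewrite le_max cell_mass_ge0.
Qed.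

Lemma cell_match_sum_right s :
  \sum_t cell_match r m n s t = m s * (N (r s) / Num.max (M (r s)) (N (r s))).
Proof.
rewrite /cell_match -big_mkcond/= [X in X / _]/N {2}/cell_mass mulr_suml mulr_sumr.
by apply: eq_big => [t|t _]; [rewrite eq_sym | rewrite mulrA].
Qed.

Lemma cell_match_sum_left t :
  \sum_s cell_match r m n s t = n t * (M (r t) / Num.max (M (r t)) (N (r t))).
Proof.
rewrite /cell_match -big_mkcond/= [X in X / _]/M {3}/cell_mass mulr_suml mulr_sumr.
by apply: eq_bigr => s /eqP ->; rewrite mulrA [n t * _]mulrC.
Qed.

Lemma cell_match_rest_left_ge0 s : 0 <= m s - \sum_t cell_match r m n s t.
Proof.
rewrite cell_match_sum_right subr_ge0 ler_piMr//.
have [->|/eqP h] := Num.max (M (r s)) (N (r s)) =P 0; first by rewrite invr0 mulr0.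
have h0 : 0 < Num.max (M (r s)) (N (r s)).
  by rewrite lt_neqAle eq_sym h le_max cell_mass_ge0.
by rewrite ler_pdivrMr// mul1r le_max lexx orbT.
Qed.

Lemma cell_match_rest_right_ge0 t : 0 <= n t - \sum_s cell_match r m n s t.
Proof.
rewrite cell_match_sum_left subr_ge0 ler_piMr//.
have [->|/eqP h] := Num.max (M (r t)) (N (r t)) =P 0; first by rewrite invr0 mulr0.
have h0 : 0 < Num.max (M (r t)) (N (r t)).
  by rewrite lt_neqAle eq_sym h le_max cell_mass_ge0.
by rewrite ler_pdivrMr// mul1r le_max lexx.
Qed.

(** In each cell the matching carries the smaller of the two masses, so only the heavier side keeps
    anything. *)
Lemma cell_mass_rest_left k :
  cell_mass r (fun s => m s - \sum_t cell_match r m n s t) k = Num.max 0 (M k - N k).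
Proof.
have -> : cell_mass r (fun s => m s - \sum_t cell_match r m n s t) k
   = M k * (1 - N k / Num.max (M k) (N k)).
  rewrite {1}/M /cell_mass mulr_suml; apply: eq_bigr => s /eqP <-.
  by rewrite cell_match_sum_right mulrBr mulr1.
have : 0 <= M k by exact: cell_mass_ge0.
have : 0 <= N k by exact: cell_mass_ge0.
move: (M k) (N k) => x y y0 x0.
have [xy|xy] := leP x y.
(* The degenerate cell: y = 0 and x <= y force x = 0, which covers the division by zero. *)
- have [ye|yn0] := eqVneq y 0.
    by have -> : x = 0; [lra | rewrite ye mul0r subrr maxxx].
  by rewrite divff// subrr mulr0 max_l// subr_le0.
- have xn0 : x != 0 by rewrite gt_eqF// (le_lt_trans y0).
  rewrite max_r ?subr_ge0 1?ltW//; field; exact: xn0.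
Qed.

Lemma cell_mass_rest_right k :
  cell_mass r (fun t => n t - \sum_s cell_match r m n s t) k = Num.max 0 (N k - M k).
Proof.
have -> : cell_mass r (fun t => n t - \sum_s cell_match r m n s t) k
   = N k * (1 - M k / Num.max (M k) (N k)).
  rewrite {1}/N /cell_mass mulr_suml; apply: eq_bigr => s /eqP <-.
  by rewrite cell_match_sum_left mulrBr mulr1.
have : 0 <= M k by exact: cell_mass_ge0.
have : 0 <= N k by exact: cell_mass_ge0.
move: (M k) (N k) => x y y0 x0.
have [xy|xy] := leP y x.
- have [xe|xn0] := eqVneq x 0.
    by have -> : y = 0; [lra | rewrite xe mul0r subrr maxxx].
  by rewrite divff// subrr mulr0 max_l// subr_le0.
- have yn0 : y != 0 by rewrite gt_eqF// (le_lt_trans x0).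
  rewrite max_r ?subr_ge0 1?ltW//; field; exact: yn0.
Qed.

(** The bound on [K] splits into a function of [s] plus a function of [t], so only the marginals of
    the matching matter, and these are at most [m] and [n]. *)
Lemma cell_match_cost (K : S -> S -> R) (c : S -> R) :
  (forall s, 0 <= c s) ->
  (forall s t, r s = r t -> K s t <= c s + c t) ->
  \sum_s \sum_t K s t * cell_match r m n s t
    <= \sum_s c s * (m s + n s).
Proof.
move=> c0 Kc.
apply: (@le_trans _ _ (\sum_s \sum_t (c s + c t) * cell_match r m n s t)).
  apply: ler_sum => s _; apply: ler_sum => t _.
  rewrite /cell_match; case: eqP => [e|_]; last by rewrite !mulr0.
  have := cell_match_ge0 s t; rewrite /cell_match e eqxx => h.
  by apply: ler_wpM2r => //; exact: Kc.
have -> : \sum_s \sum_t (c s + c t) * cell_match r m n s t =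
    \sum_s c s * \sum_t cell_match r m n s t +
    \sum_t c t * \sum_s cell_match r m n s t.
  under [X in _ + X]eq_bigr do rewrite mulr_sumr.
  rewrite [X in _ + X]exchange_big -big_split/=; apply: eq_bigr => s _.
  by rewrite mulr_sumr -big_split/=; apply: eq_bigr => t _; rewrite mulrDl.
rewrite -big_split/=; apply: ler_sum => s _; rewrite -mulrDr.
apply: ler_wpM2l => //; apply: lerD; rewrite -subr_ge0.
  exact: cell_match_rest_left_ge0.
exact: cell_match_rest_right_ge0.
Qed.

End cell_match.

Lemma maxr0_subr_norm {R : realDomainType} (x y : R) :
  Num.max 0 (x - y) + Num.max 0 (y - x) = `|x - y|.
Proof.
have [xy|xy] := leP x y.
- rewrite max_l ?subr_le0// max_r ?subr_ge0// add0r ler0_norm ?subr_le0//.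
  by rewrite opprB.
- by rewrite max_r ?subr_ge0 1?ltW// max_l ?subr_le0 1?ltW// addr0
    ger0_norm ?subr_ge0// ltW.
Qed.

(* Mass is matched greedily inside the cells of r 0, r 1, ...; what is left after stage j
   has mass (M - N)^+ and (N - M)^+ in each cell of r j, whatever was done before. *)
Lemma multiscale_matching {R : realFieldType} {S : finType} (r f : nat -> S -> S)
    (m n : S -> R) (K : S -> S -> R) (c : nat -> S -> R) (j : nat) :
  (forall s, 0 <= m s) -> (forall s, 0 <= n s) ->
  (forall i s, 0 <= c i s) ->
  (forall i s, r i.+1 s = f i (r i s)) ->
  (forall i s, (i < j)%N -> c i.+1 (r i s) = c i.+1 s) ->
  (forall i s t, (i <= j)%N -> r i s = r i t -> K s t <= c i s + c i t) ->
  exists g : S -> S -> R, [/\ forall s t, 0 <= g s t,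
    forall s, 0 <= m s - \sum_t g s t,
    forall t, 0 <= n t - \sum_s g s t,
    forall k, cell_mass (r j) (fun s => m s - \sum_t g s t) k =
                Num.max 0 (cell_mass (r j) m k - cell_mass (r j) n k) /\
              cell_mass (r j) (fun t => n t - \sum_s g s t) k =
                Num.max 0 (cell_mass (r j) n k - cell_mass (r j) m k) &
    \sum_s \sum_t K s t * g s t <= \sum_s c 0%N s * (m s + n s) +
      \sum_(i < j) \sum_k c i.+1 k * `|cell_mass (r i) m k - cell_mass (r i) n k|].
Proof.
move=> m0 n0 c0 rf; elim: j => [|j IHj] ck Kc.
  exists (cell_match (r 0%N) m n); split.
  - by move=> s t; exact: cell_match_ge0.
  - by move=> s; exact: cell_match_rest_left_ge0.
  - by move=> s; exact: cell_match_rest_right_ge0.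
  - by move=> k; rewrite cell_mass_rest_left// cell_mass_rest_right.
  - by rewrite big_ord0 addr0; apply: cell_match_cost => // s t /Kc; exact.
have [||g [g0 mg ng gk gK]] := IHj.
- by move=> i s ij; apply: ck; rewrite ltnW.
- by move=> i s t ij; apply: Kc; rewrite ltnW.
pose m' s := m s - \sum_t g s t.
pose n' t := n t - \sum_s g s t.
pose h := cell_match (r j.+1) m' n'.
have sub_max (x y : R) : Num.max 0 (x - y) - Num.max 0 (y - x) = x - y.
  by rewrite /Num.max; do 2 case: ifPn => ?; lra.
have rE : r j.+1 =1 f j \o r j by move=> s; rewrite rf.
have massE (u : S -> R) k : cell_mass (r j.+1) u k = cell_mass (f j \o r j) u k.
  by rewrite /cell_mass; apply: eq_bigl => s; rewrite rE.
(* The earlier stages matched points inside cells of [r j], hence removed equal amounts from both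
   sides of every coarser cell; the mass difference that stage j + 1 sees is the original one. *)
have diffE k : cell_mass (r j.+1) m' k - cell_mass (r j.+1) n' k =
    cell_mass (r j.+1) m k - cell_mass (r j.+1) n k.
  rewrite !massE !cell_mass_coarsen -!sumrB; apply: eq_bigr => i _.
  by rewrite (gk i).1 (gk i).2 sub_max.
exists (fun s t => g s t + h s t); split.
- by move=> s t; rewrite addr_ge0//; exact: cell_match_ge0.
- move=> s; rewrite big_split/= opprD addrA.
  exact: (cell_match_rest_left_ge0 (r j.+1) m' n').
- move=> s; rewrite big_split/= opprD addrA.
  exact: (cell_match_rest_right_ge0 (r j.+1) m' n').
- move=> k; split.
    rewrite -diffE -cell_mass_rest_left//.
    by apply: eq_bigr => s _; rewrite big_split/= opprD addrA.
  rewrite -[X in Num.max _ X]opprB -diffE opprB -cell_mass_rest_right//.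
  by apply: eq_bigr => s _; rewrite big_split/= opprD addrA.
- under eq_bigr do (under eq_bigr do rewrite mulrDr; rewrite big_split/=).
  rewrite big_split/= big_ord_recr/= addrA lerD//.
  apply: (le_trans (@cell_match_cost _ _ (r j.+1) m' n' mg ng K (c j.+1) _ _)) => //.
    by move=> s t; apply: Kc.
  (* The cost of stage j + 1 is constant on the cells of [r j], so it sees only the mass left in
     each of them, which is |M - N|. *)
  have -> : \sum_s c j.+1 s * (m' s + n' s) =
      \sum_k c j.+1 k * cell_mass (r j) (fun s => m' s + n' s) k.
    by rewrite -sum_cell_mass; apply: eq_bigr => s _; rewrite ck.
  apply: ler_sum => k _; apply: ler_wpM2l => //.
  by rewrite -maxr0_subr_norm -(gk k).1 -(gk k).2 /cell_mass -big_split/=.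
Qed.

(** At level [j] there is a single cell, in which both sides have the same mass; nothing survives
    that stage, and the partial matching has the full marginals. *)
Lemma multiscale_coupling {R : realFieldType} {S : finType} (r f : nat -> S -> S)
    (m n : S -> R) (K : S -> S -> R) (c : nat -> S -> R) (j : nat) :
  (forall s, 0 <= m s) -> (forall s, 0 <= n s) -> \sum_s m s = \sum_s n s ->
  (forall i s, 0 <= c i s) ->
  (forall i s, r i.+1 s = f i (r i s)) ->
  (forall i s, (i < j)%N -> c i.+1 (r i s) = c i.+1 s) ->
  (forall s t, r j s = r j t) ->
  (forall i s t, (i <= j)%N -> r i s = r i t -> K s t <= c i s + c i t) ->
  exists g : S -> S -> R, [/\ forall s t, 0 <= g s t,
    forall s, \sum_t g s t = m s,
    forall t, \sum_s g s t = n t &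
    \sum_s \sum_t K s t * g s t <= \sum_s c 0%N s * (m s + n s) +
      \sum_(i < j) \sum_k c i.+1 k * `|cell_mass (r i) m k - cell_mass (r i) n k|].
Proof.
move=> m0 n0 mn c0 rf ck rj Kc.
have [g [g0 mg ng gk gK]] := multiscale_matching _ f _ _ _ _ _ m0 n0 c0 rf ck Kc.
have massT (u : S -> R) s : cell_mass (r j) u (r j s) = \sum_s u s.
  by rewrite /cell_mass; apply: eq_bigl => t; rewrite (rj t s) eqxx.
exists g; split => // s.
- apply/esym/eqP; rewrite -subr_eq0; apply/eqP/le_anti; rewrite mg andbT.
  have := @le_cell_mass _ _ (r j) _ s mg.
  by rewrite (gk _).1 !massT mn subrr maxxx.
- apply/esym/eqP; rewrite -subr_eq0; apply/eqP/le_anti; rewrite ng andbT.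
  have := @le_cell_mass _ _ (r j) _ s ng.
  by rewrite (gk _).2 !massT mn subrr maxxx.
Qed.

(** * Couplings prescribed on a finite partition *)

Definition cell_prob {R : realType} {d : measure_display} {T : measurableType d}
    {S : finType} (q : T -> S) (mu : {measure set T -> \bar R}) (s : S) : R :=
  fine (mu (q @^-1` [set s])).

Lemma cell_prob_ge0 {R : realType} {d : measure_display} {T : measurableType d}
    {S : finType} (q : T -> S) (mu : {measure set T -> \bar R}) (s : S) :
  0 <= cell_prob q mu s.
Proof. exact: fine_ge0. Qed.

Section finite_cells.
Context {R : realType} {d : measure_display} {T : measurableType d}.
Context {S : finType} {q : T -> S}.
Hypothesis mq : forall s, measurable (q @^-1` [set s]).

Lemma measurable_preimage_finite (A : set S) : measurable (q @^-1` A).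
Proof.
rewrite (_ : q @^-1` A = \bigcup_(s in A) (q @^-1` [set s])).
  by apply: fin_bigcup_measurable => //; exact: finite_finset.
by apply/seteqP; split => [x Ax|x [s As /= e]]; [exists (q x) | rewrite /= e].
Qed.

Lemma measure_sum_cells (mu : {measure set T -> \bar R}) (A : set S) (B : set T) :
  measurable B ->
  (mu (B `&` q @^-1` A) = \sum_(s | s \in A) mu (B `&` q @^-1` [set s]))%E.
Proof.
move=> mB.
have -> : B `&` q @^-1` A = \bigcup_(s in A) (B `&` q @^-1` [set s]).
  by apply/seteqP; split => [x [Bx Ax]|x [s As [Bx /= e]]]; [exists (q x) | rewrite /= e].
rewrite measure_fin_bigcup; [|exact: finite_finset| |].
- rewrite fsbig_finite; last exact: finite_finset.
  rewrite -[RHS]big_enum; apply: perm_big; apply: uniq_perm; rewrite ?enum_uniq//.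
  by move=> s; rewrite mem_enum in_fset_set//; exact: finite_finset.
- by move=> s t _ _ [x [[_ /= <-] [_ /= <-]]].
- by move=> s _; exact: measurableI.
Qed.

Lemma measure_sum_cellsT (mu : {measure set T -> \bar R}) (B : set T) :
  measurable B -> (mu B = \sum_s mu (B `&` q @^-1` [set s]))%E.
Proof.
move=> mB; rewrite -{1}(setIT B) -(preimage_setT q) measure_sum_cells//.
by apply: eq_bigl => s; apply/esym; rewrite mem_set.
Qed.

Lemma cell_probE (P : probability T R) s :
  P (q @^-1` [set s]) = (cell_prob q P s)%:E.
Proof. by rewrite fineK// fin_num_measure. Qed.

Lemma sum_cell_prob (P : probability T R) : \sum_s cell_prob q P s = 1.
Proof.
apply: EFin_inj; rewrite -sumEFin -(@probability_setT _ _ _ P).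
rewrite (@measure_sum_cellsT P setT)//.
by apply: eq_bigr => s _; rewrite setTI; apply/esym; exact: cell_probE.
Qed.

End finite_cells.

(** Used to give a measure of total mass 1 the structure of a probability; [P] is the fallback value
    of [mnormalize] for degenerate total mass. *)
Lemma mnormalize_setT1 {R : realType} {d : measure_display} {T : measurableType d}
    (m : {measure set T -> \bar R}) (P : probability T R) (A : set T) :
  m setT = 1%E -> mnormalize m P A = m A.
Proof. by move=> m1; rewrite /mnormalize m1 onee_eq0/= invr1 mule1. Qed.

Section coupling_of_cells.
Context {R : realType} {d : measure_display} {T : measurableType d}.
Context {S : finType} (q : T -> S) (mu nu : probability T R) (g : S -> S -> R).
Hypothesis mq : forall s, measurable (q @^-1` [set s]).
Hypothesis g0 : forall s t, 0 <= g s t.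
Hypothesis gr : forall s, \sum_t g s t = cell_prob q mu s.
Hypothesis gc : forall t, \sum_s g s t = cell_prob q nu t.

Let cell (x : S * S) : set (T * T) := (q @^-1` [set x.1]) `*` (q @^-1` [set x.2]).

Let mcell x : measurable (cell x).
Proof. exact: measurableX. Qed.

Let weight_subproof (x : S * S) :
  0 <= g x.1 x.2 / (cell_prob q mu x.1 * cell_prob q nu x.2).
Proof. by rewrite divr_ge0// mulr_ge0// cell_prob_ge0. Qed.

Let weight (x : S * S) : {nonneg R} := NngNum (weight_subproof x).

(** Indexed by natural numbers because [msum] adds up a sequence of measures; [s0] is the default of
    [nth]. *)
Let piece (s0 : S) k : {measure set (T * T) -> \bar R} :=
  let x := nth (s0, s0) (enum {: S * S}) k in
  mscale (weight x) (mrestr (mu \x nu)%E (mcell x)).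

(** True for null cells as well: a vanishing marginal forces the entry g s t to vanish. *)
Let weightE s t :
  (weight (s, t))%:num * (cell_prob q mu s * cell_prob q nu t) = g s t.
Proof.
rewrite /=.
have [ms0|ms0] := eqVneq (cell_prob q mu s) 0.
  rewrite ms0 !mul0r mulr0; apply/esym/le_anti; rewrite g0 andbT.
  by rewrite -ms0 -gr (bigD1 t)//= lerDl sumr_ge0.
have [nt0|nt0] := eqVneq (cell_prob q nu t) 0.
  rewrite nt0 !mulr0; apply/esym/le_anti; rewrite g0 andbT.
  by rewrite -nt0 -gc (bigD1 s)//= lerDl sumr_ge0.
by rewrite divfK// mulf_neq0.
Qed.

(** On each product of two cells, take the independent coupling rescaled to mass g s t. Summing over
    one index restores the conditional law of the other marginal in each cell. *)
Lemma coupling_of_cells : exists pi : probability (T * T)%type R,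
  (forall A : set T, measurable A ->
     pushforward pi fst A = mu A /\ pushforward pi snd A = nu A) /\
  (forall s t, pi ((q @^-1` [set s]) `*` (q @^-1` [set t])) = (g s t)%:E).
Proof.
(* An empty [S] would make the cell probabilities sum to 0 instead of 1. *)
have [s0 _] : exists s : S, True.
  have [s|S0] := pickP (@predT S); first by exists s.
  have := sum_cell_prob mq mu; rewrite big_pred0//.
  by move=> /eqP; rewrite eq_sym oner_eq0.
pose pi0 : {measure set (T * T) -> \bar R} := msum (piece s0) (size (enum {: S * S})).
have pi0E (A B : set T) : measurable A -> measurable B ->
  (pi0 (A `*` B) = \sum_s \sum_t (weight (s, t))%:num%:E *
     (mu (A `&` q @^-1` [set s]) * nu (B `&` q @^-1` [set t])))%E.
  move=> mA mB; rewrite /pi0 /= /msum.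
  rewrite -(big_mkord predT (fun k => piece s0 k (A `*` B))) pair_big/=.
  rewrite -(big_nth (s0, s0) predT
    (fun x => mscale (weight x) (mrestr (mu \x nu)%E (mcell x)) (A `*` B))).
  rewrite big_enum/=; apply: eq_bigr => -[s t] _.
  rewrite /mscale/= /mrestr /cell/= -setXI product_measure1E//.
    exact: measurableI.
  exact: measurableI.
have cellI s t : s != t -> q @^-1` [set s] `&` q @^-1` [set t] = set0.
  by move=> /eqP st; apply/seteqP; split => // x [/= xs xt]; apply: st; rewrite -xs -xt.
have pi0l (A : set T) : measurable A -> pi0 (A `*` setT) = mu A.
  move=> mA; rewrite pi0E// (measure_sum_cellsT mq mu A mA).
  apply: eq_bigr => s _.
  have mAs : measurable (A `&` q @^-1` [set s]) by exact: measurableI.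
  have fA : mu (A `&` q @^-1` [set s]) = (fine (mu (A `&` q @^-1` [set s])))%:E.
    by rewrite fineK// fin_num_measure.
  rewrite fA; set y := fine _.
  under eq_bigr do rewrite setTI (cell_probE mq) -!EFinM.
  rewrite sumEFin; transitivity y%:E; [congr EFin | exact/esym/fA].
  have ys : y <= cell_prob q mu s.
    by rewrite -lee_fin -(cell_probE mq) -fA le_measure// ?inE//; exact: subIsetr.
  have y0 : 0 <= y by exact: fine_ge0.
  have [ms0|ms0] := eqVneq (cell_prob q mu s) 0.
    have -> : y = 0 by apply/le_anti; rewrite y0 -ms0 ys.
    by under eq_bigr do rewrite mul0r mulr0; rewrite sumr_const mul0rn.
  transitivity (\sum_t (y / cell_prob q mu s) * g s t).
    apply: eq_bigr => t _.
    rewrite -(weightE s t); field; exact: ms0.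
  by rewrite -mulr_sumr gr divfK.
have pi0r (B : set T) : measurable B -> pi0 (setT `*` B) = nu B.
  move=> mB; rewrite pi0E// (measure_sum_cellsT mq nu B mB) exchange_big.
  apply: eq_bigr => t _.
  have mBs : measurable (B `&` q @^-1` [set t]) by exact: measurableI.
  have fB : nu (B `&` q @^-1` [set t]) = (fine (nu (B `&` q @^-1` [set t])))%:E.
    by rewrite fineK// fin_num_measure.
  rewrite fB; set y := fine _.
  under eq_bigr do rewrite setTI (cell_probE mq) -!EFinM.
  rewrite sumEFin; transitivity y%:E; [congr EFin | exact/esym/fB].
  have yt : y <= cell_prob q nu t.
    by rewrite -lee_fin -(cell_probE mq) -fB le_measure// ?inE//; exact: subIsetr.
  have y0 : 0 <= y by exact: fine_ge0.
  have [nt0|nt0] := eqVneq (cell_prob q nu t) 0.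
    have -> : y = 0 by apply/le_anti; rewrite y0 -nt0 yt.
    by under eq_bigr do rewrite mulr0 mulr0; rewrite sumr_const mul0rn.
  transitivity (\sum_s (y / cell_prob q nu t) * g s t).
    apply: eq_bigr => s _.
    rewrite -(weightE s t); field; exact: nt0.
  by rewrite -mulr_sumr gc divfK.
have pi01 : pi0 setT = 1%E by rewrite -setXTT pi0l// probability_setT.
pose pi := mnormalize pi0 (dirac (point, point)).
have piE A : pi A = pi0 A by exact: mnormalize_setT1.
exists pi; split => [A mA|s t].
  split.
    rewrite -pi0l// (_ : A `*` setT = fst @^-1` A); first exact: piE.
    by apply/seteqP; split => // x [].
  rewrite -pi0r// (_ : setT `*` A = snd @^-1` A); first exact: piE.
  by apply/seteqP; split => // x [].
transitivity (pi0 (q @^-1` [set s] `*` q @^-1` [set t])); first exact: piE.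
rewrite pi0E//.
rewrite (bigD1 s)//= [X in (_ + X)%E]big1 ?adde0; last first.
  move=> i si; apply: big1 => j _.
  by rewrite cellI 1?eq_sym// measure0 mul0e mule0.
rewrite (bigD1 t)//= [X in (_ + X)%E]big1 ?adde0; last first.
  by move=> i ti; rewrite (cellI t) 1?eq_sym// measure0 !mule0.
rewrite !setIid !(cell_probE mq) -!EFinM; congr EFin.
exact: weightE.
Qed.

End coupling_of_cells.

(* The integral of a nonnegative function is a lower integral in the library, so it is
   monotone without any measurability. *)
Lemma le_lower_integral {R : realType} {d : measure_display} {T : measurableType d}
    (mu : {measure set T -> \bar R}) (f h : T -> \bar R) :
  (forall x, 0 <= f x)%E -> (forall x, f x <= h x)%E ->
  (\int[mu]_x f x <= \int[mu]_x h x)%E.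
Proof.
move=> f0 fh; rewrite !ge0_integralTE//; last first.
  by move=> x; exact: le_trans (fh x).
by apply: le_ereal_sup => _ [u uf <-]; exists u => // x; exact: le_trans (fh x).
Qed.

Lemma integral_pushforward_T {R : realType} {d1 d2 : measure_display}
    {T1 : measurableType d1} {T2 : measurableType d2} (phi : T1 -> T2)
    (mu : {measure set T1 -> \bar R}) (nu : {measure set T2 -> \bar R})
    (f : T2 -> R) :
  measurable_fun setT phi -> measurable_fun setT f -> (forall y, 0 <= f y) ->
  (forall A, measurable A -> pushforward mu phi A = nu A) ->
  (\int[mu]_x (f (phi x))%:E = \int[nu]_y (f y)%:E)%E.
Proof.
move=> mphi mf f0 munu.
rewrite -[LHS](@ge0_integral_pushforward _ _ _ _ _ _ mphi mu setT (EFin \o f))//.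
- by apply: eq_measure_integral => A mA _; exact: munu.
- exact/measurable_EFinP.
- by move=> y _; rewrite lee_fin.
Qed.

Lemma expR_ge1 {R : realType} (x : R) : 0 <= x -> 1 <= expR x.
Proof. by move=> x0; apply: le_trans (expR_ge1Dx x); rewrite lerDl. Qed.

Lemma exp_cost_ge0 {R : realType} (d : nat) (p a : R) (x y : 'rV[R]_d) :
  0 <= a -> 0 <= exp_cost p a x y.
Proof. by move=> a0; rewrite subr_ge0 expR_ge1// mulr_ge0 ?powR_ge0. Qed.

Lemma transport_cost_ge0 {R : realType} (d : nat) (p a : R)
    (mu nu : {measure set (borelRd R d) -> \bar R}) :
  0 <= a -> (0 <= transport_cost p a mu nu)%E.
Proof.
move=> a0; apply: le_ereal_inf_tmp => _ [pi _ <-].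
by apply: integral_ge0 => z _; rewrite lee_fin exp_cost_ge0.
Qed.

(** The part of the cost that depends on the two cells integrates to a finite sum against [g], and
    the parts that depend on one point only see the marginals. *)
Lemma transport_cost_le_cells {R : realType} (d : nat) (p a : R) {S : finType}
    (q : borelRd R d -> S) (mu nu : probability (borelRd R d) R)
    (g K : S -> S -> R) (f : borelRd R d -> R) :
  0 <= a -> (forall s, measurable (q @^-1` [set s])) ->
  (forall s t, 0 <= g s t) ->
  (forall s, \sum_t g s t = cell_prob q mu s) ->
  (forall t, \sum_s g s t = cell_prob q nu t) ->
  (forall s t, 0 <= K s t) -> measurable_fun setT f -> (forall x, 0 <= f x) ->
  (forall x y, exp_cost p a x y <= K (q x) (q y) + (f x + f y)) ->
  (transport_cost p a mu nu <=
    (\sum_s \sum_t K s t * g s t)%:E + (\int[mu]_x (f x)%:E + \int[nu]_x (f x)%:E))%E.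
Proof.
move=> a0 mq g0 gr gc K0 mf f0 cK.
have [pi [pimunu pig]] := coupling_of_cells q mu nu g mq g0 gr gc.
apply: (@le_trans _ _ (\int[pi]_z (exp_cost p a z.1 z.2)%:E)%E).
  by apply: ereal_inf_lbound; exists pi.
pose F (x : S * S) := (q @^-1` [set x.1]) `*` (q @^-1` [set x.2]).
have mF x : measurable (F x) by exact: measurableX.
pose h (z : borelRd R d * borelRd R d) :=
  (\sum_x (K x.1 x.2 * \1_(F x) z)%:E + ((f z.1)%:E + (f z.2)%:E))%E.
apply: (@le_trans _ _ (\int[pi]_z h z)%E).
  apply: le_lower_integral => z; first by rewrite lee_fin exp_cost_ge0.
  rewrite /h sumEFin -!EFinD lee_fin (le_trans (cK _ _))// lerD2r.
  rewrite (bigD1 (q z.1, q z.2))//= indicE mem_set// mulr1 lerDl.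
  by apply: sumr_ge0 => x _; rewrite mulr_ge0.
have mf1 : measurable_fun setT (fun z : borelRd R d * borelRd R d => (f z.1)%:E).
  by apply/measurable_EFinP; exact: measurableT_comp.
have mf2 : measurable_fun setT (fun z : borelRd R d * borelRd R d => (f z.2)%:E).
  by apply/measurable_EFinP; exact: measurableT_comp.
have mK x : measurable_fun setT
    (fun z : borelRd R d * borelRd R d => (K x.1 x.2 * \1_(F x) z)%:E).
  by apply/measurable_EFinP; apply: measurable_funM => //; exact: measurable_indic.
rewrite /h ge0_integralD//; last 4 first.
- by move=> z _; apply: sume_ge0 => x _; rewrite lee_fin mulr_ge0.
- exact: emeasurable_sum.
- by move=> z _; rewrite -EFinD lee_fin addr_ge0.
- exact: emeasurable_funD.
rewrite ge0_integralD//; last 2 first.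
- by move=> z _; rewrite lee_fin.
- by move=> z _; rewrite lee_fin.
apply: leeD; last first.
  rewrite (integral_pushforward_T fst pi mu)//; last by move=> A /pimunu[].
  by rewrite (integral_pushforward_T snd pi nu)//; move=> A /pimunu[].
rewrite ge0_integral_sum//; last by move=> x z _; rewrite lee_fin mulr_ge0.
rewrite pair_big/= -sumEFin; apply: lee_sum => -[s t] _ /=.
under eq_integral do rewrite EFinM.
rewrite ge0_integralZl; [|exact: measurableT|
  by apply/measurable_EFinP; exact: measurable_indic|
  by move=> z _; rewrite lee_fin|by rewrite lee_fin].
by rewrite integral_indic// setIT /F/= pig EFinM.
Qed.

(** * Deviations of empirical frequencies *)

Lemma integral_cst_probability {R : realType} {d : measure_display}
    {T : measurableType d} (P : probability T R) (x : \bar R) :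
  (\int[P]_w x = x)%E.
Proof.
by rewrite integral_cst// [X in (_ * X)%E](_ : _ = 1%E) ?mule1//; exact: probability_setT.
Qed.

Definition empirical_freq {R : realType} {disp dT : measure_display}
    {Omega : measurableType disp} {T : measurableType dT} {P : probability Omega R}
    (X : nat -> {RV P >-> T}) (N : nat) (F : set T) (w : Omega) : R :=
  N%:R^-1 * \sum_(i < N) \1_F (X i w).

Lemma empirical_measureE {R : realType} {d : nat} {disp : measure_display}
    {Omega : measurableType disp} {P : probability Omega R}
    (X : nat -> {RV P >-> borelRd R d}) (N : nat) (w : Omega) (F : set (borelRd R d)) :
  empirical_measure X N w F = (empirical_freq X N F w)%:E.
Proof.
rewrite /empirical_measure /mscale/= /msum /empirical_freq EFinM -sumEFin.
by congr (_ * _)%E; apply: eq_bigr => i _; rewrite diracE indicE.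
Qed.

(** The only place where independence enters: second moments involve pairs of samples. *)
Lemma iid_joint {R : realType} {disp dT : measure_display}
    {Omega : measurableType disp} {T : measurableType dT} {P : probability Omega R}
    (X : nat -> {RV P >-> T}) (mu : probability T R) (F : set T) (i j : nat) :
  iid_with_law X mu -> measurable F -> i != j ->
  (P ((X i @^-1` F) `&` (X j @^-1` F)) = mu F * mu F)%E.
Proof.
move=> [indX lawX] mF ij.
have := indX [fset i; j]%fset (fun=> F) (fun _ _ => mF).
rewrite big_fsetU1 ?inE//= big_seq_fset1.
have pX k : P (X k @^-1` F) = mu F by rewrite -(lawX k F mF).
rewrite !pX => <-; congr (P _); apply/seteqP; split => w /=.
  by move=> [wi wj] k /=; rewrite !inE => /orP[] /eqP ->.
by move=> h; split; apply: h => /=; rewrite !inE eqxx ?orbT.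
Qed.

Section empirical_deviation.
Context {R : realType} {disp dT : measure_display} {Omega : measurableType disp}
  {T : measurableType dT} {P : probability Omega R}.
Variables (X : nat -> {RV P >-> T}) (mu : probability T R) (N : nat) (F : set T).
Hypotheses (iidX : iid_with_law X mu) (N0 : (0 < N)%N) (mF : measurable F).

Let t := fine (mu F).
Let u := empirical_freq X N F.

Let muF : mu F = t%:E.
Proof. by rewrite fineK// fin_num_measure. Qed.

Let pX i : P (X i @^-1` F) = t%:E.
Proof. by rewrite -muF -(iidX.2 i F mF). Qed.

Let t0 : 0 <= t. Proof. exact: fine_ge0. Qed.

Let mXF i : measurable (X i @^-1` F).
Proof. by rewrite -[X in measurable X]setTI; exact: measurable_funP. Qed.

Let indicX i w : \1_F (X i w) = \1_(X i @^-1` F) w :> R.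
Proof. by rewrite !indicE. Qed.

Lemma empirical_freq_ge0 w : 0 <= u w.
Proof. by rewrite mulr_ge0 ?invr_ge0// sumr_ge0. Qed.

Lemma measurable_empirical_freq : measurable_fun setT u.
Proof.
apply: measurable_funM => //; apply: measurable_sum => i.
by under eq_fun do rewrite indicX; exact: measurable_indic.
Qed.

Let N0R : (N%:R : R) != 0. Proof. by rewrite pnatr_eq0 -lt0n. Qed.

Lemma integral_empirical_freq : (\int[P]_w (u w)%:E = t%:E)%E.
Proof.
rewrite /u /empirical_freq.
under eq_integral do rewrite EFinM -sumEFin.
rewrite ge0_integralZl; [|exact: measurableT| | |]; last 3 first.
- apply: emeasurable_sum => i; apply/measurable_EFinP.
  by under eq_fun do rewrite indicX; exact: measurable_indic.
- by move=> w _; apply: sume_ge0 => i _; rewrite lee_fin.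
- by rewrite lee_fin invr_ge0.
rewrite ge0_integral_sum//; last first.
- move=> i; apply/measurable_EFinP.
  by under eq_fun do rewrite indicX; exact: measurable_indic.
have -> : (\sum_(i < N) \int[P]_x (\1_F (X i x))%:E = \sum_(i < N) t%:E)%E.
  apply: eq_bigr => i _; under eq_integral do rewrite indicX.
  by rewrite integral_indic// setIT; exact: pX.
by rewrite sumEFin -EFinM sumr_const card_ord -[t *+ N]mulr_natl mulKf.
Qed.

Lemma integral_empirical_freq_sqr : (\int[P]_w (u w ^+ 2)%:E <= (t ^+ 2 + t / N%:R)%:E)%E.
Proof.
have uE w : (u w ^+ 2)%:E = ((N%:R ^- 2)%:E * \sum_(i < N) \sum_(j < N)
    (\1_((X i @^-1` F) `&` (X j @^-1` F)) w)%:E)%E.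
  rewrite /u /empirical_freq exprMn exprVn EFinM; congr (_ * _)%E.
  rewrite expr2 mulr_suml -sumEFin; apply: eq_bigr => i _.
  rewrite mulr_sumr -sumEFin; apply: eq_bigr => j _.
  by rewrite indicI/= !indicX.
under eq_integral do rewrite uE.
have mI i j : measurable ((X i @^-1` F) `&` (X j @^-1` F)) by exact: measurableI.
have mind i j : measurable_fun setT
    (fun w => (\1_((X i @^-1` F) `&` (X j @^-1` F)) w : R)%:E).
  by apply/measurable_EFinP; exact: measurable_indic.
rewrite ge0_integralZl; [|exact: measurableT| | |]; last 3 first.
- by apply: emeasurable_sum => i; exact: emeasurable_sum.
- by move=> w _; do 2 (apply: sume_ge0 => ? _); rewrite lee_fin.
- by rewrite lee_fin invr_ge0 exprn_ge0.
rewrite ge0_integral_sum//; last 2 first.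
- by move=> i; exact: emeasurable_sum.
- by move=> i w _; apply: sume_ge0 => ? _; rewrite lee_fin.
(* The diagonal terms equal t; allowing t^2 + t for them gives one formula for all pairs. *)
apply: (@le_trans _ _ ((N%:R ^- 2)%:E * \sum_(i < N) \sum_(j < N)
    (t ^+ 2 + (i == j)%:R * t)%:E)%E).
  apply: lee_wpmul2l; first by rewrite lee_fin invr_ge0 exprn_ge0.
  apply: lee_sum => i _; rewrite ge0_integral_sum//.
  apply: lee_sum => j _; rewrite integral_indic// setIT.
  have [<-|ij] := eqVneq i j.
    rewrite setIid [leLHS](_ : _ = t%:E); last exact: pX.
    by rewrite lee_fin mul1r lerDr sqr_ge0.
  rewrite [leLHS](_ : _ = mu F * mu F)%E; last exact: iid_joint.
  by rewrite muF mul0r addr0 lee_fin.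
under eq_bigr do rewrite sumEFin.
rewrite sumEFin -EFinM lee_fin.
have -> : \sum_(i < N) \sum_(j < N) (t ^+ 2 + (i == j)%:R * t) =
    N%:R ^+ 2 * t ^+ 2 + N%:R * t.
  transitivity (\sum_(i < N) (N%:R * t ^+ 2 + t)); last first.
    by rewrite sumr_const card_ord -[LHS]mulr_natl; ring.
  apply: eq_bigr => i _; rewrite big_split/= sumr_const card_ord mulr_natl.
  by rewrite -mulr_suml (bigD1 i)//= eqxx big1 ?addr0 ?mul1r// => k; rewrite eq_sym => /negPf ->.
by rewrite le_eqVlt; apply/orP; left; apply/eqP; field.
Qed.

(** The better of the two deviation bounds when the mass t is small compared with 1/N, where
    fluctuations of order sqrt(t/N) exceed t. *)
Lemma empirical_deviation_le2 : (\int[P]_w `|t - u w|%:E <= (2 * t)%:E)%E.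
Proof.
apply: (@le_trans _ _ (\int[P]_w (t%:E + (u w)%:E))%E).
  apply: le_lower_integral => w; first by rewrite lee_fin.
  rewrite -EFinD lee_fin (le_trans (ler_normB _ _))//.
  by rewrite !ger0_norm// empirical_freq_ge0.
rewrite ge0_integralD//; last 2 first.
- by move=> w _; rewrite lee_fin empirical_freq_ge0.
- by apply/measurable_EFinP; exact: measurable_empirical_freq.
rewrite integral_empirical_freq integral_cst_probability.
by rewrite -EFinD lee_fin mulr2n mulrDl mul1r.
Qed.

(* AM-GM in place of Jensen: |x| <= l / 2 + x^2 / (2 l), so only second moments are needed. *)
Lemma empirical_deviation_le_sqr (l : R) : 0 < l ->
  (\int[P]_w `|t - u w|%:E <= (l / 2 + t / (2 * l * N%:R))%:E)%E.
Proof.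
move=> l0.
have mu_ := measurable_empirical_freq.
(* The square (t - u)^2 is expanded and its negative cross term is moved to the left, so that only
   nonnegative functions are integrated. The mean of that term is cancelled at the end. *)
have le_pt w : `|t - u w| + t / l * u w <= (l / 2 + t ^+ 2 / (2 * l)) + (2 * l)^-1 * u w ^+ 2.
  suff : `|t - u w| <= l / 2 + (t - u w) ^+ 2 / (2 * l).
    move=> h; rewrite -lerBrDr (le_trans h)//; rewrite le_eqVlt; apply/orP; left; apply/eqP; field.
    by rewrite gt_eqF.
  have l20 : 0 < 2 * l by rewrite mulr_gt0.
  rewrite -(ler_pM2r l20).
  have -> : (l / 2 + (t - u w) ^+ 2 / (2 * l)) * (2 * l) = l ^+ 2 + `|t - u w| ^+ 2.
    by rewrite real_normK ?num_real//; field; rewrite gt_eqF.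
  by have := sqr_ge0 (`|t - u w| - l); lra.
have I1 : (\int[P]_w `|t - u w|%:E + (t / l * t)%:E <=
    (l / 2 + t ^+ 2 / (2 * l))%:E + ((2 * l)^-1 * (t ^+ 2 + t / N%:R))%:E)%E.
  have tl0 : 0 <= t / l by rewrite divr_ge0// ltW.
  have lv0 : 0 <= (2 * l)^-1 by rewrite invr_ge0 mulr_ge0// ltW.
  have m1 : measurable_fun setT (fun w => `|t - u w|%:E).
    apply/measurable_EFinP; apply: measurableT_comp => //.
    exact: measurable_funB.
  have m2 : measurable_fun setT (fun w => (t / l * u w)%:E).
    by apply/measurable_EFinP; apply: measurable_funM.
  have m3 : measurable_fun setT (fun w => ((2 * l)^-1 * u w ^+ 2)%:E).
    by apply/measurable_EFinP; apply: measurable_funM => //; exact: measurable_funX.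
  have m4 : measurable_fun setT (fun w => (u w ^+ 2)%:E).
    by apply/measurable_EFinP; exact: measurable_funX.
  have <- : (\int[P]_w (t / l * u w)%:E = (t / l * t)%:E)%E.
    under eq_integral do rewrite EFinM.
    rewrite ge0_integralZl; [|exact: measurableT|exact/measurable_EFinP| |].
    - by rewrite integral_empirical_freq.
    - by move=> w _; rewrite lee_fin empirical_freq_ge0.
    - by rewrite lee_fin.
  rewrite -ge0_integralD//; last first.
    by move=> w _; rewrite lee_fin mulr_ge0// empirical_freq_ge0.
  apply: (@le_trans _ _ (\int[P]_w ((l / 2 + t ^+ 2 / (2 * l))%:E +
      ((2 * l)^-1 * u w ^+ 2)%:E))%E).
    apply: le_lower_integral => w; rewrite -EFinD lee_fin//.
    by rewrite addr_ge0// mulr_ge0// empirical_freq_ge0.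
  rewrite ge0_integralD//; last 2 first.
  - by move=> w _; rewrite lee_fin addr_ge0// divr_ge0// ?sqr_ge0// ?mulr_ge0// ltW.
  - by move=> w _; rewrite lee_fin mulr_ge0// sqr_ge0.
  rewrite integral_cst_probability leeD2l//.
  under eq_integral do rewrite EFinM.
  rewrite ge0_integralZl; [|exact: measurableT|exact: m4| |].
  - by rewrite EFinM lee_wpmul2l ?lee_fin// integral_empirical_freq_sqr.
  - by move=> w _; rewrite lee_fin sqr_ge0.
  - by rewrite lee_fin.
rewrite -(@leeD2rE _ (t / l * t)%:E)//; apply: le_trans I1 _.
rewrite -!EFinD lee_fin; rewrite le_eqVlt; apply/orP; left; apply/eqP; field.
by rewrite gt_eqF.
Qed.

End empirical_deviation.

(** * From finite matchings to the expected transport cost *)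

(** Allows the empirical measure, typed as a mere measure, to be replaced by the probability that
    agrees with it. *)
Lemma transport_cost_eq_right {R : realType} (d : nat) (p a : R)
    (mu nu nu' : {measure set (borelRd R d) -> \bar R}) :
  (forall A, measurable A -> nu A = nu' A) ->
  transport_cost p a mu nu = transport_cost p a mu nu'.
Proof.
move=> nunu'; rewrite /transport_cost; congr ereal_inf.
suff -> : couplings mu nu = couplings mu nu' by [].
by apply/seteqP; split => pi h A mA; have [h1 h2] := h A mA; rewrite h1 h2 nunu'.
Qed.

Lemma integral_empirical_measure {R : realType} {d : nat} {disp : measure_display}
    {Omega : measurableType disp} {P : probability Omega R}
    (X : nat -> {RV P >-> borelRd R d}) (N : nat) (w : Omega) (f : borelRd R d -> R) :
  measurable_fun setT f -> (forall x, 0 <= f x) ->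
  (\int[empirical_measure X N w]_x (f x)%:E = (N%:R^-1 * \sum_(i < N) f (X i w))%:E)%E.
Proof.
move=> mf f0; rewrite /empirical_measure.
have mf' : measurable_fun setT (EFin \o f) by exact/measurable_EFinP.
rewrite ge0_integral_mscale//; last by move=> x _; rewrite /= lee_fin.
rewrite ge0_integral_measure_sum//; last by move=> x _; rewrite /= lee_fin.
rewrite EFinM -sumEFin; congr (_ * _)%E; apply: eq_bigr => i _.
by rewrite integral_dirac// diracT mul1e.
Qed.

Section expected_transport.
Context {R : realType} {d : nat} {disp : measure_display} {Omega : measurableType disp}
  {P : probability Omega R}.
Variables (X : nat -> {RV P >-> borelRd R d}) (mu : probability (borelRd R d) R) (N : nat).
Hypotheses (iidX : iid_with_law X mu) (N0 : (0 < N)%N).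

Let emp_setT w : empirical_measure X N w setT = 1%E.
Proof.
rewrite empirical_measureE /empirical_freq.
under eq_bigr do rewrite indicT.
by rewrite sumr_const card_ord -[1 *+ N]/(N%:R) mulVf// pnatr_eq0 -lt0n.
Qed.

Let emp w : probability (borelRd R d) R := mnormalize (empirical_measure X N w) mu.

Let empE w A : emp w A = empirical_measure X N w A.
Proof. exact: mnormalize_setT1. Qed.

Let integral_empirical (f : borelRd R d -> R) : measurable_fun setT f -> (forall x, 0 <= f x) ->
  (\int[P]_w (N%:R^-1 * \sum_(i < N) f (X i w))%:E = \int[mu]_x (f x)%:E)%E.
Proof.
move=> mf f0.
have mfX i : measurable_fun setT (fun w => (f (X i w))%:E).
  by apply/measurable_EFinP; exact: measurableT_comp.
under eq_integral do rewrite EFinM -sumEFin.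
rewrite ge0_integralZl; [|exact: measurableT|exact: emeasurable_sum| |]; last 2 first.
- by move=> w _; apply: sume_ge0 => i _; rewrite lee_fin.
- by rewrite lee_fin invr_ge0.
rewrite ge0_integral_sum//; last by move=> i w _; rewrite lee_fin.
rewrite (eq_bigr (fun=> \int[mu]_x (f x)%:E)%E); last first.
  by move=> i _; apply: integral_pushforward_T => // A mA; exact: (iidX.2 i A mA).
set I := (\int[mu]_x (f x)%:E)%E.
have -> : (\sum_(i < N) I = (\sum_(i < N) 1%:E) * I)%E.
  by rewrite ge0_sume_distrl//; apply: eq_bigr => i _; rewrite mul1e.
rewrite sumEFin sumr_const card_ord muleA -EFinM -[1 *+ N]/(N%:R) mulVf ?mul1e//.
by rewrite pnatr_eq0 -lt0n.
Qed.

Lemma cell_prob_comp {S : finType} {q : borelRd R d -> S} (r : S -> S)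
    (nu : probability (borelRd R d) R) (k : S) :
  (forall s, measurable (q @^-1` [set s])) ->
  cell_prob (r \o q) nu k = cell_mass r (cell_prob q nu) k.
Proof.
move=> mq; apply: EFin_inj; rewrite /cell_prob fineK; last first.
  rewrite fin_num_measure// comp_preimage; exact: (measurable_preimage_finite mq).
rewrite comp_preimage -(setTI (q @^-1` _)) (measure_sum_cells mq)//.
rewrite /cell_mass -sumEFin; apply: eq_big => [s|s _].
  by apply/idP/eqP; rewrite inE.
by rewrite setTI; exact: cell_probE.
Qed.

(** For every sample, the multiscale coupling of the cell masses is lifted to R^d. In the mean the
    empirical masses become those of [mu], whence the two factors 2, and the matching costs leave
    the mean absolute deviations. *)
Lemma expected_transport_le (p a : R) {S : finType} (q : borelRd R d -> S)
    (r h : nat -> S -> S) (K : S -> S -> R) (c : nat -> S -> R) (j : nat)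
    (f : borelRd R d -> R) :
  0 <= a -> (forall s, measurable (q @^-1` [set s])) ->
  (forall i s, 0 <= c i s) ->
  (forall i s, r i.+1 s = h i (r i s)) ->
  (forall i s, (i < j)%N -> c i.+1 (r i s) = c i.+1 s) ->
  (forall s t, r j s = r j t) ->
  (forall s t, 0 <= K s t) ->
  (forall i s t, (i <= j)%N -> r i s = r i t -> K s t <= c i s + c i t) ->
  measurable_fun setT f -> (forall x, 0 <= f x) ->
  (forall x y, exp_cost p a x y <= K (q x) (q y) + (f x + f y)) ->
  (\int[P]_w transport_cost p a mu (empirical_measure X N w) <=
    (2 * \sum_s c 0%N s * cell_prob q mu s)%:E +
    \sum_(i < j) \sum_k (c i.+1 k)%:E *
      \int[P]_w `|cell_prob (r i \o q) mu k -
                  empirical_freq X N ((r i \o q) @^-1` [set k]) w|%:E +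
    2%:E * \int[mu]_x (f x)%:E)%E.
Proof.
move=> a0 mq c0 rh cr rj K0 Kc mf f0 fK.
pose dev i k w := `|cell_prob (r i \o q) mu k -
                  empirical_freq X N ((r i \o q) @^-1` [set k]) w|.
have mrq i k : measurable ((r i \o q) @^-1` [set k]).
  by rewrite comp_preimage; exact: (measurable_preimage_finite mq).
have mdev i k : measurable_fun setT (fun w => (dev i k w)%:E).
  apply/measurable_EFinP; apply: measurableT_comp => //.
  by apply: measurable_funB => //; exact: (measurable_empirical_freq _ _ _ (mrq i k)).
have empq i k w : cell_prob (r i \o q) (emp w) k =
    empirical_freq X N ((r i \o q) @^-1` [set k]) w.
  apply: EFin_inj; rewrite -empirical_measureE -empE fineK//.
  exact: fin_num_measure.
have empq0 s w : cell_prob q (emp w) s = empirical_freq X N (q @^-1` [set s]) w.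
  apply: EFin_inj; rewrite -empirical_measureE -empE fineK//.
  exact: fin_num_measure.
(* A measurable pointwise majorant of the transport cost, nested to the right so that its integral
   can be split one summand at a time. *)
pose G w := ((\sum_s c 0%N s * cell_prob q mu s)%:E + (
    (\sum_s (c 0%N s * empirical_freq X N (q @^-1` [set s]) w)%:E) + (
    \sum_(i < j) \sum_k (c i.+1 k * dev i k w)%:E + (
    \int[mu]_x (f x)%:E +
    (N%:R^-1 * \sum_(i < N) f (X i w))%:E))))%E.
apply: (@le_trans _ _ (\int[P]_w G w)%E).
  apply: le_lower_integral => w; first exact: transport_cost_ge0.
  rewrite (@transport_cost_eq_right _ _ _ _ mu _ (emp w)); last first.
    by move=> A mA; apply/esym; exact: empE.
  have [g [g0 gr gc gK]] := multiscale_coupling r h (cell_prob q mu)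
    (cell_prob q (emp w)) K c j (cell_prob_ge0 _ _) (cell_prob_ge0 _ _)
    (etrans (sum_cell_prob mq mu) (esym (sum_cell_prob mq (emp w)))) c0 rh cr rj Kc.
  apply: (le_trans (transport_cost_le_cells d p a q mu (emp w) g K f a0 mq g0 gr gc K0 mf f0 fK)).
  have -> : (\int[emp w]_x (f x)%:E = (N%:R^-1 * \sum_(i < N) f (X i w))%:E)%E.
    apply: etrans (integral_empirical_measure X N w f mf f0).
    by apply: eq_measure_integral => A mA _; exact: empE.
  have devE : (\sum_(i < j) \sum_k (c i.+1 k * dev i k w)%:E =
      (\sum_(i < j) \sum_k c i.+1 k * dev i k w)%:E)%E.
    by rewrite -sumEFin; apply: eq_bigr => i _; rewrite -sumEFin.
  rewrite /G devE sumEFin.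
  move: (\int[mu]_x (f x)%:E)%E (_ * _)%:E => I J.
  rewrite !addeA leeD2r// leeD2r//.
  rewrite -!EFinD lee_fin (le_trans gK)//.
  apply: lerD.
    rewrite -big_split/=; apply: ler_sum => s _.
    by rewrite -empq0 mulrDr.
  apply: ler_sum => i _; apply: ler_sum => k _.
  by rewrite /dev -empq !cell_prob_comp.
have mq0 s : measurable_fun setT
    (fun w => (c 0%N s * empirical_freq X N (q @^-1` [set s]) w)%:E).
  apply/measurable_EFinP; apply: measurable_funM => //.
  exact: (measurable_empirical_freq _ _ _ (mq s)).
have mcdevS i k : measurable_fun setT (fun w => (c i.+1 k * dev i k w)%:E).
  apply/measurable_EFinP; apply: measurable_funM; first exact: measurable_cst.
  by apply/measurable_EFinP; exact: mdev.
have mfX : measurable_fun setT (fun w => (N%:R^-1 * \sum_(i < N) f (X i w))%:E).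
  apply/measurable_EFinP; apply: measurable_funM => //; apply: measurable_sum => i.
  exact: measurableT_comp.
have If0 : (0 <= \int[mu]_x (f x)%:E)%E.
  by apply: integral_ge0 => x _; rewrite lee_fin.
have fX0 w : (0 <= (N%:R^-1 * \sum_(i < N) f (X i w))%:E)%E.
  by rewrite lee_fin mulr_ge0 ?invr_ge0// sumr_ge0.
have m3 : measurable_fun setT (fun w => \sum_(i < j) \sum_k (c i.+1 k * dev i k w)%:E)%E.
  by apply: emeasurable_sum => i; exact: emeasurable_sum.
have p3 w : (0 <= \sum_(i < j) \sum_k (c i.+1 k * dev i k w)%:E)%E.
  by do 2 (apply: sume_ge0 => ? _); rewrite lee_fin mulr_ge0 ?normr_ge0.
have p2 w : (0 <= \sum_s (c 0%N s * empirical_freq X N (q @^-1` [set s]) w)%:E)%E.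
  by apply: sume_ge0 => ? _; rewrite lee_fin mulr_ge0 ?empirical_freq_ge0.
have m2 : measurable_fun setT
   (fun w => \sum_s (c 0%N s * empirical_freq X N (q @^-1` [set s]) w)%:E)%E.
  exact: emeasurable_sum.
have m4 : measurable_fun setT (fun w : Omega => (\int[mu]_x (f x)%:E +
    (N%:R^-1 * \sum_(i < N) f (X i w))%:E)%E).
  exact: emeasurable_funD.
have p4 w : (0 <= \int[mu]_x (f x)%:E + (N%:R^-1 * \sum_(i < N) f (X i w))%:E)%E.
  exact: adde_ge0.
have p1 : (0 <= (\sum_s c 0%N s * cell_prob q mu s)%:E)%E.
  by rewrite lee_fin sumr_ge0// => s _; rewrite mulr_ge0// cell_prob_ge0.
have m34 := emeasurable_funD m3 m4.
have m234 := emeasurable_funD m2 m34.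
have p34 w := adde_ge0 (p3 w) (p4 w).
have p234 w := adde_ge0 (p2 w) (p34 w).
rewrite /G ge0_integralD//.
rewrite ge0_integralD//.
rewrite ge0_integralD//.
rewrite ge0_integralD//.
rewrite !integral_cst_probability integral_empirical//.
rewrite ge0_integral_sum//; last first.
  by move=> s w _; rewrite lee_fin mulr_ge0// empirical_freq_ge0.
have -> : (\sum_s \int[P]_w (c 0%N s * empirical_freq X N (q @^-1` [set s]) w)%:E =
    (\sum_s c 0%N s * cell_prob q mu s)%:E)%E.
  rewrite -sumEFin; apply: eq_bigr => s _.
  under eq_integral do rewrite EFinM.
  rewrite ge0_integralZl; [|exact: measurableT| | |].
  - by rewrite (integral_empirical_freq X mu)// EFinM.
  - by apply/measurable_EFinP; exact: (measurable_empirical_freq _ _ _ (mq s)).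
  - by move=> w _; rewrite lee_fin empirical_freq_ge0.
  - by rewrite lee_fin.
have -> : (\int[P]_w (\sum_(i < j) \sum_k (c i.+1 k * dev i k w)%:E) =
    \sum_(i < j) \sum_k (c i.+1 k)%:E * \int[P]_w (dev i k w)%:E)%E.
  rewrite ge0_integral_sum//; last 2 first.
  - by move=> i; exact: emeasurable_sum.
  - by move=> i w _; apply: sume_ge0 => k _; rewrite lee_fin mulr_ge0 ?normr_ge0.
  apply: eq_bigr => i _; rewrite ge0_integral_sum//; last first.
    by move=> k w _; rewrite lee_fin mulr_ge0 ?normr_ge0.
  apply: eq_bigr => k _; under eq_integral do rewrite EFinM.
  rewrite ge0_integralZl; [by []|exact: measurableT|exact: mdev| |by rewrite lee_fin].
  by move=> w _; rewrite lee_fin normr_ge0.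
rewrite addeA -EFinD addeA -mulr2n -[_ *+ 2]mulr_natl.
by rewrite (_ : 2%:E = (1 + 1)%:E)%E// EFinD ge0_muleDl// mul1e.
Qed.

End expected_transport.

(** * Dyadic annuli and cubes *)

Lemma measurable_truncn {R : realType} : measurable_fun setT (Num.truncn : R -> nat).
Proof.
have mle k : measurable [set x : R | (Num.truncn x <= k)%N].
  rewrite (_ : [set x | _] = `]-oo, k.+1%:R[%classic); first exact: measurable_itv.
  by apply/seteqP; split => x /=; rewrite in_itv/= truncn_le_nat.
move=> _ B _; rewrite setTI.
rewrite (_ : _ @^-1` B = \bigcup_(k in B) [set x : R | Num.truncn x = k]); last first.
  by apply/seteqP; split => [x Bx|x [k Bk /= xk]]; [exists (Num.truncn x)|rewrite /= xk].
apply: bigcup_measurable => -[|k] _.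
  rewrite (_ : [set x | _] = [set x : R | (Num.truncn x <= 0)%N]); first exact: mle.
  by apply/seteqP; split => x /=; [move=> ->|rewrite leqn0 => /eqP].
rewrite (_ : [set x | _] = [set x : R | (Num.truncn x <= k.+1)%N] `\`
  [set x : R | (Num.truncn x <= k)%N]); first exact: measurableD.
apply/seteqP; split => x /=; first by move=> ->; split => //; rewrite ltnn.
by move=> [] h /negP; rewrite -ltnNge => h'; apply/eqP; rewrite eqn_leq h.
Qed.

Lemma measurable_coord {R : realType} (d : nat) (i : 'I_d) :
  measurable_fun setT (fun x : borelRd R d => (x : 'rV[R]_d) ord0 i).
Proof.
apply: (measurability _ (RGenOpens.measurableE R)) => _ [_ [x [y ->]] <-].
rewrite setTI; apply: sub_sigma_algebra.
apply: open_comp; last exact: interval_open.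
by move=> z _; exact: coord_continuous.
Qed.

Lemma measurable_enorm {R : realType} (d : nat) :
  measurable_fun setT (fun x : borelRd R d => enorm x).
Proof.
have m : measurable_fun setT
    (fun x : borelRd R d => \sum_(i < d) (x : 'rV[R]_d) ord0 i ^+ 2).
  by apply: measurable_sum => i; apply: measurable_funX; exact: measurable_coord.
have h := measurableT_comp (continuous_measurable_fun (@sqrt_continuous R)) m.
exact h.
Qed.

(* Index of the dyadic annulus of x; all of |x| >= 2 ^ (M - 1) is put in the last one. *)
Definition annulus {R : realType} {d : nat} (M : nat) (x : 'rV[R]_d) : nat :=
  minn M (up_log 2 (Num.truncn (enorm x)).+1).

(** The affine map takes [-2^n, 2^n] to [0, 2^L]. The right end point has index 2^L, hence the 2^L +
    1 values of the labels; the minimum caps the coordinates beyond it. *)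
Definition grid {R : realType} (L n : nat) (y : R) : nat :=
  minn (2 ^ L) (Num.truncn (2 ^+ L * ((y / 2 ^+ n + 1) / 2))).

Definition cell_label {R : realType} {d : nat} (M L : nat) (x : 'rV[R]_d) :
    'I_M.+1 * {ffun 'I_d -> 'I_(2 ^ L).+1} :=
  (inord (annulus M x), [ffun i => inord (grid L (annulus M x) (x ord0 i))]).

(* Cells of level j <= L have side 2 ^ (n + 1 + j - L) in annulus n; level L + 1 is trivial. *)
Definition coarsen {d M L : nat} (j : nat)
    (s : 'I_M.+1 * {ffun 'I_d -> 'I_(2 ^ L).+1}) :
    'I_M.+1 * {ffun 'I_d -> 'I_(2 ^ L).+1} :=
  if (j <= L)%N then (s.1, [ffun i => inord (s.2 i %/ 2 ^ j)])
  else (ord0, [ffun=> ord0]).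

Definition coarsen_step {d M L : nat} (j : nat)
    (s : 'I_M.+1 * {ffun 'I_d -> 'I_(2 ^ L).+1}) :=
  if (j < L)%N then coarsen 1 s else (ord0, [ffun=> ord0]).

Lemma coarsenS {d M L : nat} (j : nat) (s : 'I_M.+1 * {ffun 'I_d -> 'I_(2 ^ L).+1}) :
  coarsen j.+1 s = coarsen_step j (coarsen j s).
Proof.
rewrite /coarsen_step {1}/coarsen; case: ltnP => // jL.
rewrite /coarsen (ltnW jL) (leq_trans _ jL)//=; congr (_, _).
apply/ffunP => i; rewrite !ffunE inordK; last first.
  by rewrite ltnS (leq_trans (leq_div _ _))// -ltnS.
by rewrite -divnMA -expnSr.
Qed.

Lemma annulus_le {R : realType} {d : nat} (M : nat) (x : 'rV[R]_d) :
  (annulus M x <= M)%N.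
Proof. exact: geq_minl. Qed.

Lemma grid_le {R : realType} (L n : nat) (y : R) : (grid L n y <= 2 ^ L)%N.
Proof. exact: geq_minl. Qed.

Lemma measurable_cell {R : realType} {d : nat} (M L : nat)
    (s : 'I_M.+1 * {ffun 'I_d -> 'I_(2 ^ L).+1}) :
  measurable ((cell_label M L : borelRd R d -> _) @^-1` [set s]).
Proof.
case: s => n k.
rewrite (_ : _ @^-1` _ = (annulus M : borelRd R d -> _) @^-1` [set nat_of_ord n] `&`
  \bigcap_(i in [set: 'I_d]) ((fun x : borelRd R d => grid L n ((x : 'rV[R]_d) ord0 i))
     @^-1` [set nat_of_ord (k i)])).
  have ma : measurable_fun setT (annulus M : borelRd R d -> nat).
    apply: (@measurableT_comp _ _ _ _ _ _ (fun m : nat => minn M (up_log 2 m.+1))) => //.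
    by apply: measurableT_comp; [exact: measurable_truncn|exact: measurable_enorm].
  have mg i : measurable_fun setT
      (fun x : borelRd R d => grid L n ((x : 'rV[R]_d) ord0 i)).
    apply: (@measurableT_comp _ _ _ _ _ _ (fun m : nat => minn (2 ^ L) m)) => //.
    apply: measurableT_comp; first exact: measurable_truncn.
    apply: measurable_funM => //; apply: measurable_funM => //.
    apply: measurable_funD => //; apply: measurable_funM => //.
    exact: measurable_coord.
  apply: measurableI; first by rewrite -[X in measurable X]setTI; exact: ma.
  apply: fin_bigcap_measurable; first exact: finite_finset.
  by move=> i _; rewrite -[X in measurable X]setTI; exact: mg.
apply/seteqP; split => [x [] <- <-|x [/= xn xk]] /=.
  split => [|i _]; first by rewrite /= inordK// ltnS annulus_le.
  by rewrite /= ffunE !inordK// ltnS ?grid_le ?annulus_le.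
congr (_, _); first by apply: val_inj; rewrite /= inordK -?xn// ltnS annulus_le.
apply/ffunP => i; apply: val_inj; rewrite ffunE/= inordK ?ltnS ?grid_le//.
by rewrite xn; exact: (xk i).
Qed.

Lemma enorm_ge0 {R : realType} {d : nat} (x : 'rV[R]_d) : 0 <= enorm x.
Proof. exact: sqrtr_ge0. Qed.

Lemma enorm_sqr {R : realType} {d : nat} (x : 'rV[R]_d) :
  enorm x ^+ 2 = \sum_(i < d) x ord0 i ^+ 2.
Proof. by rewrite sqr_sqrtr// sumr_ge0// => i _; rewrite sqr_ge0. Qed.

(** Sum (x_i - y_i)^2 <= 2 x_i^2 + 2 y_i^2 over the coordinates; this replaces the triangle
    inequality. *)
Lemma enorm_sub_le_max {R : realType} {d : nat} (x y : 'rV[R]_d) (c : R) :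
  enorm x <= c -> enorm y <= c -> enorm (x - y) <= 2 * c.
Proof.
move=> xc yc; have c0 : 0 <= c by rewrite (le_trans (enorm_ge0 x)).
rewrite -(@ler_sqr _ (enorm _)) ?nnegrE ?mulr_ge0 ?enorm_ge0// enorm_sqr.
apply: (@le_trans _ _ (2 * enorm x ^+ 2 + 2 * enorm y ^+ 2)).
  rewrite !enorm_sqr !mulr_sumr -big_split/=; apply: ler_sum => i _.
  by rewrite !mxE; have := sqr_ge0 (x ord0 i + y ord0 i); lra.
have : enorm x ^+ 2 <= c ^+ 2 by rewrite ler_sqr ?nnegrE ?enorm_ge0.
have : enorm y ^+ 2 <= c ^+ 2 by rewrite ler_sqr ?nnegrE ?enorm_ge0.
by rewrite exprMn; lra.
Qed.

Lemma coord_le_enorm {R : realType} {d : nat} (x : 'rV[R]_d) (i : 'I_d) :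
  `|x ord0 i| <= enorm x.
Proof.
rewrite -(@ler_sqr _ `|_|) ?nnegrE ?enorm_ge0// enorm_sqr real_normK ?num_real//.
by rewrite (bigD1 i)//= lerDl sumr_ge0// => j _; rewrite sqr_ge0.
Qed.

Lemma enorm_le_coord {R : realType} {d : nat} (x : 'rV[R]_d) (c : R) : 0 <= c ->
  (forall i, `|x ord0 i| <= c) -> enorm x <= Num.sqrt d%:R * c.
Proof.
move=> c0 xc; rewrite -(@ler_sqr _ (enorm _)) ?nnegrE ?mulr_ge0 ?sqrtr_ge0 ?enorm_ge0//.
rewrite enorm_sqr exprMn sqr_sqrtr// mulr_natl -[d in _ *+ d]card_ord -sumr_const.
by apply: ler_sum => i _; rewrite -real_normK ?num_real// ler_sqr ?nnegrE.
Qed.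

Lemma annulus_lt {R : realType} {d : nat} (M : nat) (x : 'rV[R]_d) :
  (annulus M x < M)%N -> enorm x < 2 ^+ annulus M x.
Proof.
rewrite /annulus => h; have -> : minn M (up_log 2 (Num.truncn (enorm x)).+1) =
    up_log 2 (Num.truncn (enorm x)).+1.
  by apply/minn_idPr; move: h; rewrite gtn_min ltnn/= => /ltnW.
by rewrite -natrX -truncn_lt_nat ?enorm_ge0// up_logP.
Qed.

Lemma annulus_ge {R : realType} {d : nat} (M : nat) (x : 'rV[R]_d) (n : nat) :
  (n.+1 <= annulus M x)%N -> 2 ^+ n <= enorm x.
Proof.
rewrite /annulus leq_min => /andP[_ nx].
rewrite -natrX -truncn_ge_nat ?enorm_ge0// leqNgt; apply/negP => h.
by have := up_log_min (ltnSn 1) h; rewrite leqNgt nx.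
Qed.

Lemma grid_close {R : realType} (L n j : nat) (y z : R) :
  `|y| <= 2 ^+ n -> `|z| <= 2 ^+ n ->
  (grid L n y %/ 2 ^ j = grid L n z %/ 2 ^ j)%N ->
  `|y - z| <= 2 * 2 ^+ n * (2 ^+ j / 2 ^+ L).
Proof.
have p2 k : 0 < 2 ^+ k :> R by rewrite exprn_gt0.
(* The rescaled coordinate lies in the half-open interval of length 2^j given by its level j index;
   for |v| <= 2^n the cap 2^L changes nothing. *)
have main (v : R) : `|v| <= 2 ^+ n ->
    (grid L n v %/ 2 ^ j)%:R * 2 ^+ j <= 2 ^+ L * ((v / 2 ^+ n + 1) / 2) <
      ((grid L n v %/ 2 ^ j)%:R + 1) * 2 ^+ j.
  rewrite ler_norml => /andP[v1 v2].
  have u1 : -1 <= v / 2 ^+ n by rewrite ler_pdivlMr// mulN1r.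
  have u2 : v / 2 ^+ n <= 1 by rewrite ler_pdivrMr// mul1r.
  move: u1 u2; rewrite /grid; move: (v / 2 ^+ n) => q u1 u2.
  set u := 2 ^+ L * _.
  have u0 : 0 <= u by apply: mulr_ge0; [exact: ltW|lra].
  have uL : u <= 2 ^+ L by rewrite /u; apply: ler_piMr; [exact: ltW|lra].
  have -> : minn (2 ^ L) (Num.truncn u) = Num.truncn u.
    apply/minn_idPr; rewrite -[X in (_ <= X)%N](@natrK R) le_truncn//.
    by rewrite natrX.
  have /andP[t1 t2] := truncn_itv u0.
  apply/andP; split.
    by apply: le_trans t1; rewrite -natrX -natrM ler_nat leq_divM.
  apply: (lt_le_trans t2); rewrite -natrX natr1 -natrM ler_nat.
  by rewrite ltn_ceil// expn_gt0.
move=> /main/andP[y1 y2] /main/andP[z1 z2] e; move: y1 y2; rewrite e => y1 y2.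
have yz : y - z = 2 * 2 ^+ n * ((2 ^+ L * ((y / 2 ^+ n + 1) / 2) -
    2 ^+ L * ((z / 2 ^+ n + 1) / 2)) / 2 ^+ L).
  by field; rewrite !gt_eqF.
have c0 : 0 <= 2 * 2 ^+ n :> R by rewrite mulr_ge0// ltW.
have iL0 : 0 <= (2 ^+ L)^-1 :> R by rewrite invr_ge0 ltW.
rewrite yz normrM (ger0_norm c0); apply: ler_wpM2l => //.
rewrite normrM (ger0_norm iL0); apply: ler_wpM2r => //.
by rewrite ler_norml; apply/andP; split; lra.
Qed.

Lemma same_cell_close {R : realType} {d : nat} (M L j : nat) (x y : 'rV[R]_d) :
  (j <= L)%N -> (annulus M x < M)%N ->
  coarsen j (cell_label M L x) = coarsen j (cell_label M L y) ->
  annulus M x = annulus M y /\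
  enorm (x - y) <= Num.sqrt d%:R * (2 * 2 ^+ annulus M x * (2 ^+ j / 2 ^+ L)).
Proof.
rewrite /coarsen => -> xM [] /(congr1 val); rewrite /= !inordK ?ltnS ?annulus_le// => exy ek.
have yM : (annulus M y < M)%N by rewrite -exy.
split => //; apply: enorm_le_coord.
  by rewrite !mulr_ge0 ?exprn_ge0// invr_ge0 exprn_ge0.
move=> i; rewrite !mxE; apply: grid_close.
- by rewrite (le_trans (coord_le_enorm _ _))// ltW// annulus_lt.
- by rewrite (le_trans (coord_le_enorm _ _))// ltW// exy annulus_lt.
- have /(congr1 val) := congr1 (fun g : {ffun _} => g i) ek.
  have gb n (v : R) : ((inord (grid L n v) : 'I_(2 ^ L).+1) %/ 2 ^ j < (2 ^ L).+1)%N.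
    by rewrite ltnS (leq_trans (leq_div _ _))// -ltnS.
  by rewrite !ffunE /= !inordK ?ltnS ?grid_le ?exy// (leq_trans (leq_div _ _))// grid_le.
Qed.

Lemma enorm_distC {R : realType} {d : nat} (x y : 'rV[R]_d) : enorm (x - y) = enorm (y - x).
Proof.
rewrite /enorm; congr Num.sqrt; apply: eq_bigr => i _.
by rewrite !mxE -[LHS]sqrrN opprB.
Qed.

Lemma powR_exprn {R : realType} (x p : R) (n : nat) : 0 <= x ->
  (x ^+ n) `^ p = (x `^ p) ^+ n.
Proof.
by move=> x0; rewrite -powR_mulrn// -powRrM mulrC powRrM powR_mulrn ?powR_ge0.
Qed.

(** This is 1 - u <= exp(-u) multiplied by exp(u). *)
Lemma expR_sub1_le {R : realType} (u : R) : expR u - 1 <= u * expR u.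
Proof.
have : expR u * (1 + - u) <= expR u * expR (- u).
  by apply: ler_wpM2l; [exact: expR_ge0|exact: expR_ge1Dx].
by rewrite expRxMexpNx_1 mulrDr mulr1 mulrN [expR u * u]mulrC; lra.
Qed.

(** * Transport costs inside a cell, between annuli and in the tail *)

Section multiscale_cost.
Context {R : realType} (d : nat) (p a b : R) (M L : nat).
Hypotheses (a0 : 0 < a) (p0 : 0 < p) (p1 : p < 1) (ab : 2 * a < b) (M0 : (0 < M)%N).

Local Notation S := ('I_M.+1 * {ffun 'I_d -> 'I_(2 ^ L).+1})%type.

Definition ring_height (n : nat) : R := (2 `^ p) ^+ n.

(** The exponential bounds exp(a |x - y|^p) on the ball of radius 2^n. In the prefactor, the height
    pays for the linear factor of exp(u) - 1 <= u exp(u), and the 1 makes the weight dominate the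
    plain exponential. *)
Definition ring_weight (n : nat) : R :=
  (1 + ring_height n) * expR (2 * a * ring_height n).

Definition scale_const : R := 1 + a * (2 * Num.sqrt d%:R) `^ p.

(** The last ratio is 2^(p (j - L)): up to a constant, the p-th power of the side of a level [j]
    cell relative to its annulus. *)
Definition scale_cost (j : nat) (s : S) : R :=
  scale_const * ring_weight s.1 * ((2 `^ p) ^+ j / (2 `^ p) ^+ L).

(** The matching needs one cost below c_j s + c_j t at every level j where [s] and [t] share a cell,
    hence the minimum. Pairs touching the last annulus cost 0 here because they are charged to the
    tail terms. *)
Definition pair_cost (s t : S) : R :=
  if (s.1 == M :> nat) || (t.1 == M :> nat) then 0 else
  \big[Num.min/scale_cost L.+1 s + scale_cost L.+1 t]_(j < L.+1 |
     coarsen j s == coarsen j t) (scale_cost j s + scale_cost j t).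

Lemma powR2_gt1 : 1 < 2 `^ p :> R.
Proof.
have := @gt0_ltr_powR R p p0 1 2; rewrite !nnegrE powR1; apply => //.
by rewrite ltr1n.
Qed.

Lemma powR2_le2 : 2 `^ p <= 2 :> R.
Proof. by apply: ler1_powR; [rewrite ler1n|exact: ltW]. Qed.

Let rho0 : 0 < 2 `^ p :> R. Proof. exact: lt_trans ltr01 powR2_gt1. Qed.

Lemma ring_height_ge1 n : 1 <= ring_height n.
Proof. by rewrite /ring_height exprn_ege1// ltW// powR2_gt1. Qed.

Let height0 n : 0 <= ring_height n.
Proof. exact: le_trans ler01 (ring_height_ge1 n). Qed.

Lemma ring_heightE n : ring_height n = (2 ^+ n) `^ p.
Proof. by rewrite /ring_height powR_exprn. Qed.

Lemma ring_weight_ge n : expR (2 * a * ring_height n) <= ring_weight n.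
Proof. by rewrite /ring_weight ler_peMl ?expR_ge0// lerDl. Qed.

Lemma ring_weight_ge0 n : 0 <= ring_weight n.
Proof. exact: le_trans (expR_ge0 _) (ring_weight_ge n). Qed.

Lemma scale_const_ge1 : 1 <= scale_const.
Proof. by rewrite /scale_const lerDl mulr_ge0 ?powR_ge0// ltW. Qed.

Lemma scale_cost_ge0 j (s : S) : 0 <= scale_cost j s.
Proof.
rewrite /scale_cost mulr_ge0 ?divr_ge0 ?exprn_ge0 ?powR_ge0// mulr_ge0 ?ring_weight_ge0//.
exact: le_trans ler01 scale_const_ge1.
Qed.

Lemma scale_cost_coarsen i j (s : S) : (i < L.+1)%N ->
  scale_cost j (coarsen i s) = scale_cost j s.
Proof. by rewrite ltnS /scale_cost /coarsen => ->. Qed.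

(** At level L + 1 the scale ratio is 2^p > 1, so this level can pay for moves between different
    annuli. *)
Lemma scale_cost_top (s : S) : expR (2 * a * ring_height s.1) <= scale_cost L.+1 s.
Proof.
apply: (le_trans (ring_weight_ge _)); rewrite /scale_cost exprS mulrK; last first.
  by rewrite unitfE expf_neq0// gt_eqF.
apply: (@le_trans _ _ (scale_const * ring_weight s.1)).
  by apply: ler_peMl; [exact: ring_weight_ge0|exact: scale_const_ge1].
apply: ler_peMr; last by rewrite ltW// powR2_gt1.
by rewrite mulr_ge0 ?ring_weight_ge0//; exact: le_trans ler01 scale_const_ge1.
Qed.

(** Source of the factor 2 a: |x - y| <= 2 c, and 2^p <= 2 because p < 1. *)
Lemma exp_cost_le_height (x y : 'rV[R]_d) (c : R) :
  enorm x <= c -> enorm y <= c -> a * enorm (x - y) `^ p <= 2 * a * c `^ p.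
Proof.
move=> xc yc; have c0 : 0 <= c by rewrite (le_trans (enorm_ge0 x)).
rewrite [leRHS](_ : _ = a * (2 * c `^ p)); last by ring.
apply: ler_wpM2l; first exact: ltW.
apply: (@le_trans _ _ ((2 * c) `^ p)).
  apply: ge0_ler_powR; rewrite ?nnegrE ?enorm_ge0 ?mulr_ge0//; first exact: ltW.
  exact: enorm_sub_le_max.
by rewrite powRM//; apply: ler_wpM2r; [exact: powR_ge0|exact: powR2_le2].
Qed.

Let label_val (x : 'rV[R]_d) : (cell_label M L x).1 = annulus M x :> nat.
Proof. by rewrite /= inordK// ltnS annulus_le. Qed.

(** In exp(u) - 1 <= u exp(u), the linear factor is bounded by the diameter of the cell and the
    exponential only by the radius of the annulus. *)
Lemma exp_cost_same_cell j (x y : 'rV[R]_d) : (j <= L)%N -> (annulus M x < M)%N ->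
  coarsen j (cell_label M L x) = coarsen j (cell_label M L y) ->
  exp_cost p a x y <= scale_cost j (cell_label M L x).
Proof.
move=> jL xM e; have [exy close] := same_cell_close _ _ _ _ _ jL xM e.
have xn := ltW (annulus_lt _ _ xM).
have yn : enorm y <= 2 ^+ annulus M x by rewrite exy ltW// annulus_lt// -exy.
rewrite /scale_cost label_val; set n := annulus M x in xn yn close *.
apply: (le_trans (expR_sub1_le _)).
have e1 : expR (a * enorm (x - y) `^ p) <= expR (2 * a * ring_height n).
  by rewrite ler_expR ring_heightE exp_cost_le_height.
have e2 : enorm (x - y) `^ p <=
    (2 * Num.sqrt d%:R) `^ p * ring_height n * ((2 `^ p) ^+ j / (2 `^ p) ^+ L).
  have -> : (2 `^ p) ^+ j / (2 `^ p) ^+ L = (2 ^+ j / 2 ^+ L) `^ p :> R.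
    rewrite powRM ?invr_ge0 ?exprn_ge0// powR_exprn//.
    have L20 : 0 <= 2 ^+ L :> R by rewrite exprn_ge0.
    by rewrite -(powR_inv1 L20) -powRrM mulN1r powRN powR_exprn.
  rewrite ring_heightE -!powRM ?mulr_ge0 ?sqrtr_ge0 ?exprn_ge0 ?invr_ge0 ?exprn_ge0//.
  apply: ge0_ler_powR; rewrite ?nnegrE ?enorm_ge0//; first exact: ltW.
  apply: le_trans close _; rewrite le_eqVlt; apply/orP; left; apply/eqP.
  by rewrite !mulrA [2 * Num.sqrt _]mulrC.
set r := (2 `^ p) ^+ j / _ in e2 *.
have r0 : 0 <= r by rewrite divr_ge0 ?exprn_ge0 ?powR_ge0.
set s0 := (2 * Num.sqrt d%:R) `^ p in e2.
have s00 : 0 <= s0 by exact: powR_ge0.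
apply: (@le_trans _ _ (a * (s0 * ring_height n * r) * expR (2 * a * ring_height n))).
  apply: ler_pM; [|exact: expR_ge0| |exact: e1].
    by rewrite mulr_ge0 ?powR_ge0// ltW.
  by apply: ler_wpM2l; first exact: ltW.
rewrite /ring_weight /scale_const -/s0.
have -> : a * (s0 * ring_height n * r) * expR (2 * a * ring_height n) =
   (a * s0 * ring_height n) * (expR (2 * a * ring_height n) * r) by ring.
rewrite [leRHS](_ : _ = (1 + a * s0) * (1 + ring_height n) *
  (expR (2 * a * ring_height n) * r)); last by ring.
apply: ler_wpM2r; first by rewrite mulr_ge0 ?expR_ge0.
have as0 : 0 <= a * s0 by rewrite mulr_ge0// ltW.
rewrite [leRHS](_ : _ = a * s0 * ring_height n + (1 + a * s0 + ring_height n)).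
  by rewrite lerDl !addr_ge0.
by ring.
Qed.

(** The point in the outer annulus alone pays for the move. *)
Lemma exp_cost_top (x y : 'rV[R]_d) : (annulus M x < M)%N -> (annulus M y < M)%N ->
  exp_cost p a x y <= scale_cost L.+1 (cell_label M L x) + scale_cost L.+1 (cell_label M L y).
Proof.
move=> xM yM; have := scale_cost_top (cell_label M L x).
have := scale_cost_top (cell_label M L y); rewrite !label_val => ty tx.
have h (m n : nat) (u v : 'rV[R]_d) : (m <= n)%N -> enorm u <= 2 ^+ m -> enorm v <= 2 ^+ n ->
    exp_cost p a u v <= expR (2 * a * ring_height n).
  move=> mn um vn; rewrite /exp_cost lerBlDr (@le_trans _ _ (expR (2 * a * ring_height n)))//.
    rewrite ler_expR ring_heightE exp_cost_le_height// (le_trans um)// ler_weXn2l//.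
    by rewrite ler1n.
  by rewrite lerDl.
have [xy|/ltnW yx] := leqP (annulus M x) (annulus M y).
  apply: le_trans (h _ _ _ _ xy (ltW (annulus_lt _ _ xM)) (ltW (annulus_lt _ _ yM))) _.
  by rewrite (le_trans ty)// lerDr scale_cost_ge0.
have -> : exp_cost p a x y = exp_cost p a y x by rewrite /exp_cost enorm_distC.
apply: le_trans (h _ _ _ _ yx (ltW (annulus_lt _ _ yM)) (ltW (annulus_lt _ _ xM))) _.
by rewrite (le_trans tx)// lerDl scale_cost_ge0.
Qed.

Definition tail_factor : R := expR (- ((b - 2 * a) * ring_height M.-1)).

(** Let c be the larger norm. Then c >= 2^(M-1), and exp(2 a c^p) = exp(b c^p) exp(-(b - 2 a) c^p),
    whose last factor is at most [tail_factor]. *)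
Lemma exp_cost_tail (x y : 'rV[R]_d) : (annulus M x == M) || (annulus M y == M) ->
  exp_cost p a x y <= tail_factor * expR (b * enorm x `^ p) +
                      tail_factor * expR (b * enorm y `^ p).
Proof.
have far (z : 'rV[R]_d) : annulus M z == M -> 2 ^+ M.-1 <= enorm z.
  by move=> /eqP zM; apply: (annulus_ge M); rewrite zM prednK.
move=> /orP xyM; pose c := Num.max (enorm x) (enorm y).
have cM : 2 ^+ M.-1 <= c by rewrite le_max; case: xyM => /far ->; rewrite ?orbT.
have c0 : 0 <= c by rewrite le_max enorm_ge0.
apply: (@le_trans _ _ (tail_factor * expR (b * c `^ p))).
  rewrite /exp_cost lerBlDr (@le_trans _ _ (expR (2 * a * c `^ p)))//.
    by rewrite ler_expR exp_cost_le_height// le_max lexx ?orbT.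
  apply: ler_wpDr => //; rewrite /tail_factor -expRD ler_expR ring_heightE.
  have : (b - 2 * a) * (2 ^+ M.-1) `^ p <= (b - 2 * a) * c `^ p.
    apply: ler_wpM2l; first by rewrite subr_ge0 ltW.
    by apply: ge0_ler_powR; rewrite ?nnegrE ?exprn_ge0//; exact: ltW.
  by rewrite !mulrBl; lra.
rewrite /c; case: (leP (enorm x) (enorm y)) => _.
  by rewrite lerDr mulr_ge0 ?expR_ge0.
by rewrite lerDl mulr_ge0 ?expR_ge0.
Qed.

Lemma pair_cost_ge0 (s t : S) : 0 <= pair_cost s t.
Proof.
rewrite /pair_cost; case: ifP => // _; apply: le_bigmin.
  by rewrite addr_ge0 ?scale_cost_ge0.
by move=> j _; rewrite addr_ge0 ?scale_cost_ge0.
Qed.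

Lemma pair_cost_le j (s t : S) : (j <= L.+1)%N -> coarsen j s = coarsen j t ->
  pair_cost s t <= scale_cost j s + scale_cost j t.
Proof.
move=> jL st; rewrite /pair_cost; case: ifP => [_|_].
  by rewrite addr_ge0 ?scale_cost_ge0.
have [jL'|] := ltnP j L.+1.
  by apply: (@bigmin_le_cond _ _ _ _ (Ordinal jL')); apply/eqP.
move=> Lj; rewrite (_ : j = L.+1); first exact: bigmin_le_id.
by apply/eqP; rewrite eqn_leq jL.
Qed.

Lemma exp_cost_le_pair (x y : 'rV[R]_d) :
  exp_cost p a x y <= pair_cost (cell_label M L x) (cell_label M L y) +
    (tail_factor * expR (b * enorm x `^ p) + tail_factor * expR (b * enorm y `^ p)).
Proof.
have t0 (z : 'rV[R]_d) : 0 <= tail_factor * expR (b * enorm z `^ p).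
  by rewrite mulr_ge0 ?expR_ge0.
rewrite /pair_cost !label_val; case: ifPn => [h|].
  by rewrite add0r; exact: exp_cost_tail.
rewrite negb_or => /andP[xM' yM'].
have xM : (annulus M x < M)%N by rewrite ltn_neqAle xM' annulus_le.
have yM : (annulus M y < M)%N by rewrite ltn_neqAle yM' annulus_le.
apply: ler_wpDr; first by rewrite addr_ge0.
apply: le_bigmin; first exact: exp_cost_top.
move=> j /eqP e; apply: le_trans (exp_cost_same_cell j _ _ (ltn_ord j) xM e) _.
by rewrite lerDl scale_cost_ge0.
Qed.

End multiscale_cost.

(** * Summation over annuli and scales *)

(** Optimising in l gives z <= sqrt(K t / N). Write z = z^(1 - 2 th) z^(2 th), bound the first
    factor by 2 t and the second by the square root, and use 2^(1 - 2 th) <= 2. *)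
Lemma interpolate_moment_bounds {R : realType} (z t K N th : R) :
  0 <= z -> 0 <= t -> 0 < K -> 0 < N -> 0 <= th -> th <= 2^-1 ->
  z <= 2 * t -> (forall l, 0 < l -> z <= K * (l / 2) + t / (2 * l * N)) ->
  z <= 2 * t `^ (1 - th) * (K / N) `^ th.
Proof.
move=> z0 t0 K0 N0 th0 th2 zt zl.
have KN0 : 0 <= K / N by rewrite divr_ge0// ltW.
have [tE|tn0] := eqVneq t 0.
  apply: (@le_trans _ _ 0); first by move: zt; rewrite tE mulr0.
  by rewrite mulr_ge0 ?powR_ge0// mulr_ge0// powR_ge0.
have [zE|zn0] := eqVneq z 0.
  by rewrite zE mulr_ge0 ?powR_ge0// mulr_ge0// powR_ge0.
have tp : 0 < t by rewrite lt_neqAle eq_sym tn0.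
pose y := Num.sqrt (K / N * t).
have y0 : 0 < y by rewrite sqrtr_gt0 mulr_gt0// divr_gt0.
have y2 : y ^+ 2 = K / N * t by rewrite sqr_sqrtr// mulr_ge0.
have zy : z <= y.
  (* The minimiser of K l / 2 + t / (2 l N), at which both summands equal y / 2. *)
  have := zl (y / K) (divr_gt0 y0 K0).
  have -> : K * (y / K / 2) + t / (2 * (y / K) * N) = y / 2 + (K / N * t) / (2 * y).
    by field; rewrite !gt_eqF.
  have -> : y / 2 + (K / N * t) / (2 * y) = y by rewrite -y2; field; rewrite gt_eqF.
  by [].
have -> : z = z `^ (1 - 2 * th) * z `^ (2 * th).
  rewrite -powRD; first by rewrite subrK powRr1.
  by rewrite zn0 implybT.
have zz : z `^ (1 - 2 * th) <= 2 * t `^ (1 - 2 * th).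
  apply: (@le_trans _ _ ((2 * t) `^ (1 - 2 * th))).
    by apply: ge0_ler_powR; rewrite ?nnegrE ?mulr_ge0//; lra.
  rewrite powRM//; apply: ler_wpM2r; first exact: powR_ge0.
  by apply: ler1_powR; [rewrite ler1n|lra].
have zy2 : z `^ (2 * th) <= (K / N) `^ th * t `^ th.
  rewrite -powRM// -y2.
  have -> : (y ^+ 2) `^ th = y `^ (2 * th) by rewrite -powR_mulrn ?ltW// -powRrM.
  by apply: ge0_ler_powR; rewrite ?nnegrE ?mulr_ge0// ltW.
apply: (@le_trans _ _ ((2 * t `^ (1 - 2 * th)) * ((K / N) `^ th * t `^ th))).
  by apply: ler_pM => //; exact: powR_ge0.
have -> : t `^ (1 - th) = t `^ (1 - 2 * th) * t `^ th.
  rewrite -powRD; first by congr (_ `^ _); lra.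
  by rewrite tn0 implybT.
by rewrite le_eqVlt; apply/orP; left; apply/eqP; ring.
Qed.

Lemma sum_geometric_lt1 {R : realFieldType} (x : R) (n : nat) : 0 <= x -> x < 1 ->
  \sum_(i < n) x ^+ i <= (1 - x)^-1.
Proof.
move=> x0 x1; have x1' : 0 < 1 - x by rewrite subr_gt0.
rewrite -[leRHS]mul1r ler_pdivlMr// mulrC.
have -> : (1 - x) * \sum_(i < n) x ^+ i = 1 - x ^+ n.
  by rewrite -[RHS]opprB subrX1 -mulNr opprB.
by rewrite lerBlDr lerDl exprn_ge0.
Qed.

Lemma sum_geometric_gt1 {R : realFieldType} (x : R) (n : nat) : 1 < x ->
  \sum_(i < n) x ^+ i <= x ^+ n / (x - 1).
Proof.
move=> x1; have x1' : 0 < x - 1 by rewrite subr_gt0.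
by rewrite ler_pdivlMr// mulrC -subrX1 lerBlDr lerDl.
Qed.

(** From exp(x) >= x^2 / 2 and 1 + V <= 2 V. The decay 1/V suffices, as V will be the geometric
    sequence of the heights. *)
Lemma linear_times_exp_le {R : realType} (c V : R) : 0 < c -> 1 <= V ->
  (1 + V) * expR (- (c * V)) <= 4 / c ^+ 2 * V^-1.
Proof.
move=> c0 V1; have V0 : 0 < V by rewrite (lt_le_trans ltr01).
have := expR_ge1Dxn 1 (mulr_ge0 (ltW c0) (ltW V0)); rewrite (_ : 2`! = 2)%N// => h.
rewrite expRN ler_pdivrMr ?expR_gt0// -(@ler_pM2l _ (c ^+ 2 * V)); last first.
  by rewrite mulr_gt0// exprn_gt0.
have -> : c ^+ 2 * V * (4 / c ^+ 2 / V * expR (c * V)) = 4 * expR (c * V).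
  by field; rewrite !gt_eqF.
apply: (@le_trans _ _ (2 * (c * V) ^+ 2)); last by lra.
have -> : c ^+ 2 * V * (1 + V) = c ^+ 2 * (V + V ^+ 2) by ring.
have -> : 2 * (c * V) ^+ 2 = c ^+ 2 * (2 * V ^+ 2) by ring.
apply: ler_wpM2l; first by rewrite exprn_ge0// ltW.
have : 0 <= V * (V - 1) by rewrite mulr_ge0 ?subr_ge0// ltW.
by rewrite expr2; lra.
Qed.

(** The positive quantity b (1 - th) / 2^p - 2 a is the net rate of decay in the height of the
    annulus. The bound does not depend on [m], which frees the cutoff index. *)
Lemma sum_ring_weight_le {R : realType} (p a b B th : R) (t : nat -> R) (m : nat) :
  0 < p -> 0 <= B -> th <= 1 ->
  0 < b * (1 - th) / 2 `^ p - 2 * a ->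
  (forall n, 0 <= t n) ->
  (forall n, t n <= B * expR (- (b * (ring_height p n / 2 `^ p)))) ->
  \sum_(n < m) ring_weight p a n * t n `^ (1 - th) <=
    B `^ (1 - th) * (4 / (b * (1 - th) / 2 `^ p - 2 * a) ^+ 2) * (1 - (2 `^ p)^-1)^-1.
Proof.
move=> p0 B0 th1; set c := _ - 2 * a => c0 t0 tB.
have rho1 := powR2_gt1 p p0.
have rho0 : 0 < 2 `^ p :> R by exact: lt_trans ltr01 rho1.
apply: (@le_trans _ _ (\sum_(n < m) B `^ (1 - th) * (4 / c ^+ 2) * (2 `^ p)^-1 ^+ n)).
  apply: ler_sum => n _; have V1 := ring_height_ge1 p p0 n.
  have tp : t n `^ (1 - th) <=
      B `^ (1 - th) * expR (- (b * (1 - th) / 2 `^ p * ring_height p n)).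
    apply: (@le_trans _ _ ((B * expR (- (b * (ring_height p n / 2 `^ p)))) `^ (1 - th))).
      by apply: ge0_ler_powR; rewrite ?nnegrE ?mulr_ge0 ?expR_ge0// subr_ge0.
    rewrite powRM ?expR_ge0// -expRM le_eqVlt; apply/orP; left; apply/eqP.
    by congr (_ * expR _); ring.
  apply: (@le_trans _ _ (ring_weight p a n * (B `^ (1 - th) *
      expR (- (b * (1 - th) / 2 `^ p * ring_height p n))))).
    by apply: ler_wpM2l => //; exact: ring_weight_ge0.
  have -> : ring_weight p a n * (B `^ (1 - th) *
      expR (- (b * (1 - th) / 2 `^ p * ring_height p n))) =
      B `^ (1 - th) * ((1 + ring_height p n) * expR (- (c * ring_height p n))).
    rewrite /ring_weight /c mulrBl opprB expRD; ring.
  rewrite -mulrA; apply: ler_wpM2l; first exact: powR_ge0.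
  apply: le_trans (linear_times_exp_le _ _ c0 V1) _.
  by rewrite /ring_height exprVn.
rewrite -mulr_sumr; apply: ler_wpM2l.
  by rewrite mulr_ge0 ?powR_ge0// divr_ge0// exprn_ge0// ltW.
by apply: sum_geometric_lt1; [rewrite invr_ge0 ltW|rewrite invf_lt1].
Qed.

Lemma card_le_ord (m c : nat) : (#|[pred y : 'I_m.+1 | (y <= c)%N]| <= c.+1)%N.
Proof.
rewrite cardE -(size_map val) -(size_iota 0 c.+1); apply: uniq_leq_size.
  by rewrite map_inj_uniq ?enum_uniq//; exact: val_inj.
by move=> _ /mapP[y + ->]; rewrite mem_enum inE mem_iota add0n ltnS.
Qed.

Lemma card_le_ffun (d m c : nat) : (0 < d)%N ->
  (#|[pred g : {ffun 'I_d -> 'I_m.+1} | [forall i, (g i <= c)%N]]| <= c.+1 ^ d)%N.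
Proof.
move=> d0; rewrite (@eq_card _ _ (ffun_on [pred y : 'I_m.+1 | (y <= c)%N])).
  by rewrite card_ffun_on card_ord leq_exp2r// card_le_ord.
move=> g; rewrite [LHS]inE; apply/forallP/ffun_onP => h i; have := h i.
  by rewrite inE.
by rewrite inE.
Qed.

(** * Masses of the annuli *)

Section ring_masses.
Context {R : realType} (d : nat) (p a b E : R) (M L : nat).
Variable mu : probability (borelRd R d) R.
Hypotheses (p0 : 0 < p) (b0 : 0 < b).
Hypothesis muE : (\int[mu]_y (expR (b * enorm y `^ p))%:E = E%:E)%E.

Local Notation S := ('I_M.+1 * {ffun 'I_d -> 'I_(2 ^ L).+1})%type.
Local Notation q := (cell_label M L : borelRd R d -> S).

Definition ring_mass (n : nat) : R := \sum_(s : S | s.1 == n :> nat) cell_prob q mu s.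

Lemma ring_mass_ge0 n : 0 <= ring_mass n.
Proof. by apply: sumr_ge0 => s _; exact: cell_prob_ge0. Qed.

Lemma ring_massE n :
  (ring_mass n)%:E = mu (q @^-1` [set s : S | s.1 = n :> nat]).
Proof.
rewrite -(setTI (q @^-1` _)) (measure_sum_cells (measurable_cell M L))//.
rewrite /ring_mass -sumEFin; apply: eq_big => [s|s _].
  by apply/eqP/idP; rewrite inE.
by rewrite setTI; apply/esym; exact: (cell_probE (measurable_cell M L)).
Qed.

Lemma measurable_ring n : measurable (q @^-1` [set s : S | s.1 = n :> nat]).
Proof. exact: (measurable_preimage_finite (measurable_cell M L)). Qed.

Lemma ring_mass_le1 n : ring_mass n <= 1.
Proof.
rewrite -lee_fin ring_massE; apply: (@probability_le1 _ _ _ mu).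
exact: measurable_ring.
Qed.

Lemma exp_moment_ge1 : 1 <= E.
Proof.
rewrite -lee_fin -muE -{1}(integral_cst_probability mu 1%:E).
apply: le_lower_integral => x; rewrite lee_fin//.
by apply: expR_ge1; rewrite mulr_ge0 ?powR_ge0// ltW.
Qed.

Lemma measurable_exp_moment :
  measurable_fun setT (fun y : borelRd R d => expR (b * enorm y `^ p)).
Proof.
apply: measurableT_comp => //; apply: measurable_funM => //.
exact (measurableT_comp (@measurable_powR R p) (@measurable_enorm R d)).
Qed.

(** Markov's inequality for exp(b |y|^p): annulus n + 1 lies outside the ball of radius 2^n, hence
    the division by 2^p. The factor exp(b) covers n = 0, where the mass is merely at most 1. *)
Lemma ring_mass_tail n :
  ring_mass n <= E * expR b * expR (- (b * (ring_height p n / 2 `^ p))).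
Proof.
have rho0 : 0 < 2 `^ p :> R by exact: lt_trans ltr01 (powR2_gt1 p p0).
have E1 := exp_moment_ge1.
case: n => [|n].
  apply: (le_trans (ring_mass_le1 0)).
  rewrite -mulrA -expRD -[leLHS]mul1r; apply: ler_pM => //.
  apply: expR_ge1; rewrite subr_ge0; apply: ler_piMr; first exact: ltW.
  by rewrite /ring_height expr0 mul1r invf_le1//; exact/ltW/(powR2_gt1 p p0).
have -> : ring_height p n.+1 / 2 `^ p = ring_height p n.
  by rewrite /ring_height exprS mulrC mulKf// gt_eqF.
apply: (@le_trans _ _ (E * expR (- (b * ring_height p n)))); last first.
  rewrite -mulrA; apply: ler_wpM2l; first exact: le_trans ler01 E1.
  by apply: ler_peMl; [exact: expR_ge0|apply: expR_ge1; exact: ltW].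
rewrite expRN ler_pdivlMr ?expR_gt0// -lee_fin -muE EFinM ring_massE muleC.
set A := q @^-1` _; have mA : measurable A by exact: measurable_ring.
have -> : ((expR (b * ring_height p n))%:E * mu A =
    \int[mu]_x ((expR (b * ring_height p n))%:E * (\1_A x)%:E))%E.
  rewrite ge0_integralZl; [|exact: measurableT| | |]; last 3 first.
  - by apply/measurable_EFinP; exact: measurable_indic.
  - by move=> x _; rewrite lee_fin.
  - by rewrite lee_fin expR_ge0.
  by rewrite integral_indic// setIT.
apply: le_lower_integral => x; rewrite -EFinM lee_fin ?mulr_ge0 ?expR_ge0//.
rewrite indicE; case: (boolP (x \in A)) => [|_]; last by rewrite mulr0 expR_ge0.
rewrite inE mulr1 /A/= inordK ?ltnS ?annulus_le// => xn.
rewrite ler_expR; apply: ler_wpM2l; first exact: ltW.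
rewrite ring_heightE; apply: ge0_ler_powR; rewrite ?nnegrE ?exprn_ge0 ?enorm_ge0//.
  exact: ltW.
by apply: (annulus_ge M); rewrite xn.
Qed.

Lemma ring_mass_coarsen i n : (i <= L)%N ->
  \sum_(k : S | k.1 == n :> nat) cell_prob (coarsen i \o q) mu k = ring_mass n.
Proof.
move=> iL; have c1 (s : S) : (coarsen i s).1 = s.1 by rewrite /coarsen iL.
under eq_bigr do rewrite (cell_prob_comp _ _ _ (measurable_cell M L)).
rewrite [RHS](partition_big (coarsen i) (fun k : S => k.1 == n :> nat))/=.
  apply: eq_bigr => k /eqP kn; rewrite /cell_mass; apply: eq_bigl => s.
  by case: eqP => [e|]; rewrite ?andbF// -c1 e kn eqxx.
by move=> s; rewrite c1.
Qed.

End ring_masses.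

(** * Expected cost as a sum over annuli and scales *)

Section expected_cost.
Context {R : realType} (d : nat) (p a b E : R) (M L N : nat).
Context {disp : measure_display} {Omega : measurableType disp} {P : probability Omega R}.
Variables (X : nat -> {RV P >-> borelRd R d}) (mu : probability (borelRd R d) R).
Hypotheses (d0 : (0 < d)%N) (a0 : 0 < a) (p0 : 0 < p) (p1 : p < 1).
Hypotheses (ab : 2 * a < b) (M0 : (0 < M)%N) (N0 : (0 < N)%N).
Hypothesis muE : (\int[mu]_y (expR (b * enorm y `^ p))%:E = E%:E)%E.
Hypothesis iidX : iid_with_law X mu.

Local Notation S := ('I_M.+1 * {ffun 'I_d -> 'I_(2 ^ L).+1})%type.
Local Notation q := (cell_label M L : borelRd R d -> S).

Let b0 : 0 < b. Proof. by rewrite (lt_trans _ ab)// mulr_gt0. Qed.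

Definition cell_deviation (i : nat) (k : S) : \bar R :=
  (\int[P]_w `|cell_prob (coarsen i \o q) mu k -
               empirical_freq X N ((coarsen i \o q) @^-1` [set k]) w|%:E)%E.

Let mcell i (k : S) : measurable ((coarsen i \o q) @^-1` [set k]).
Proof.
by rewrite comp_preimage; exact: (measurable_preimage_finite (measurable_cell M L)).
Qed.

Lemma cell_deviation_ge0 i k : (0 <= cell_deviation i k)%E.
Proof. by apply: integral_ge0 => w _; rewrite lee_fin. Qed.

Lemma cell_deviation_empty i k : (coarsen i \o q) @^-1` [set k] = set0 ->
  cell_deviation i k = 0%E.
Proof.
move=> e; rewrite /cell_deviation /cell_prob e measure0/=.
rewrite -[RHS](integral_cst_probability P 0%E); apply: eq_integral => w _.
rewrite /empirical_freq big1 ?mulr0 ?subr0 ?normr0// => i0 _.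
by rewrite indic0.
Qed.

(** The two deviation bounds are summed over the cells of the annulus, with the same l for all
    cells, and only the sums are interpolated. *)
Lemma ring_deviation_le th (n i : nat) : (i <= L)%N -> 0 <= th -> th <= 2^-1 ->
  (\sum_(k : S | k.1 == n :> nat) cell_deviation i k <=
   (2 * ring_mass d M L mu n `^ (1 - th) *
      (((2 ^ (L - i)).+1 ^ d)%:R / N%:R) `^ th)%:E)%E.
Proof.
move=> iL th0 th2; set t := ring_mass _ _ _ _ _; set K := ((2 ^ (L - i)).+1 ^ d)%N.
have tE := ring_mass_coarsen d M L mu i n iL; rewrite -/t in tE.
set D := (\sum_(k | _) _)%E.
have D0 : (0 <= D)%E by apply: sume_ge0 => k _; exact: cell_deviation_ge0.
have D2 : (D <= (2 * t)%:E)%E.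
  rewrite -tE mulr_sumr -sumEFin; apply: lee_sum => k _.
  exact: (empirical_deviation_le2 X mu N _ iidX N0 (mcell i k)).
have Dfin : D \is a fin_num by rewrite ge0_fin_numE// (le_lt_trans D2)// ltry.
rewrite -(fineK Dfin) lee_fin; apply: interpolate_moment_bounds => //.
- exact: fine_ge0.
- exact: ring_mass_ge0.
- by rewrite ltr0n expn_gt0.
- by rewrite ltr0n.
- by rewrite -lee_fin fineK.
move=> l l0; rewrite -lee_fin fineK//.
(* Labels at level [i] live in the same type as the finest ones, but coarsening reaches only indices
   up to 2^(L - i). The others have empty cells, so K cells remain to be counted. *)
pose small (k : S) := [forall m, (k.2 m <= 2 ^ (L - i))%N].
have Dsmall : D = (\sum_(k : S | (k.1 == n :> nat) && small k) cell_deviation i k)%E.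
  rewrite /D (bigID small)/= [X in (_ + X)%E]big1 ?adde0// => k /andP[_ /negP nk].
  apply: cell_deviation_empty; apply/seteqP; split => // x /= xk; apply: nk.
  rewrite -xk /coarsen iL; apply/forallP => m; rewrite ffunE/=.
  have h : (((cell_label M L x).2 m : nat) %/ 2 ^ i <= 2 ^ (L - i))%N.
    by rewrite expnB//; apply: leq_div2r; rewrite -ltnS.
  by rewrite inordK// ltnS (leq_trans h)// leq_pexp2l// leq_subr.
rewrite Dsmall; apply: (@le_trans _ _ (\sum_(k : S | (k.1 == n :> nat) && small k)
    (l / 2 + cell_prob (coarsen i \o q) mu k / (2 * l * N%:R))%:E)%E).
  apply: lee_sum => k _.
  exact: (empirical_deviation_le_sqr X mu N _ iidX N0 (mcell i k)).
rewrite sumEFin lee_fin big_split/=; apply: lerD.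
  rewrite sumr_const -[_ *+ _]mulr_natl; apply: ler_wpM2r; first by rewrite divr_ge0// ltW.
  rewrite ler_nat; apply: leq_trans (card_le_ffun d (2 ^ L) (2 ^ (L - i)) d0).
  rewrite -(@card_in_imset _ _ snd).
    apply: subset_leq_card; apply/fintype.subsetP => g /imsetP[k /andP[_ ks] ->].
    exact: ks.
  move=> [k1 g1] [k2 g2] /andP[/= /eqP e1 _] /andP[/= /eqP e2 _] /= ->.
  by congr (_, _); apply: val_inj; rewrite /= e1 e2.
rewrite -mulr_suml; apply: ler_wpM2r; first by rewrite invr_ge0 mulr_ge0// mulr_ge0// ltW.
rewrite -tE [leRHS](bigID small)/= lerDl; apply: sumr_ge0 => k _.
exact: cell_prob_ge0.
Qed.

Lemma expected_cost_le_levels :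
  (\int[P]_w transport_cost p a mu (empirical_measure X N w) <=
    (2 * \sum_(s : S) scale_cost d p a M L 0 s * cell_prob q mu s)%:E +
    \sum_(i < L.+1) \sum_(k : S) (scale_cost d p a M L i.+1 k)%:E * cell_deviation i k +
    (2 * (tail_factor p a b M * E))%:E)%E.
Proof.
have mf : measurable_fun setT
    (fun x : borelRd R d => tail_factor p a b M * expR (b * enorm x `^ p)).
  apply: measurable_funM => //; exact: measurable_exp_moment.
have f0 (x : borelRd R d) : 0 <= tail_factor p a b M * expR (b * enorm x `^ p).
  by rewrite mulr_ge0 ?expR_ge0.
have fE : (\int[mu]_x (tail_factor p a b M * expR (b * enorm x `^ p))%:E =
    (tail_factor p a b M * E)%:E)%E.
  under eq_integral do rewrite EFinM.
  rewrite ge0_integralZl; [|exact: measurableT| | |].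
  - by rewrite muE EFinM.
  - by apply/measurable_EFinP; exact: measurable_exp_moment.
  - by move=> x _; rewrite lee_fin expR_ge0.
  - by rewrite lee_fin expR_ge0.
apply: le_trans (expected_transport_le X mu N iidX N0 p a q coarsen coarsen_step
  (pair_cost d p a M L) (scale_cost d p a M L) L.+1 _ (ltW a0) (measurable_cell M L)
  _ _ _ _ _ _ mf f0 _) _.
- by move=> i s; exact: scale_cost_ge0.
- by move=> i s; exact: coarsenS.
- by move=> i s iL; exact: scale_cost_coarsen.
- by move=> s t; rewrite /coarsen ltnn.
- by move=> s t; exact: pair_cost_ge0.
- by move=> i s t; exact: pair_cost_le.
- by move=> x y; exact: exp_cost_le_pair.
by rewrite fE -EFinM.
Qed.

Lemma sum_scale_cost_ring j (F : S -> \bar R) : (forall k, 0 <= F k)%E ->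
  (\sum_(k : S) (scale_cost d p a M L j k)%:E * F k =
   \sum_(n < M.+1) (scale_const d p a * ring_weight p a n *
        ((2 `^ p) ^+ j / (2 `^ p) ^+ L))%:E * \sum_(k : S | k.1 == n :> nat) F k)%E.
Proof.
move=> F0; rewrite (partition_big (fun k : S => k.1) predT)//=.
apply: eq_bigr => n _; rewrite ge0_sume_distrr//.
by apply: eq_big => [k|k /eqP <-].
Qed.

Lemma expected_cost_le_rings th : 0 <= th -> th <= 2^-1 ->
  (\int[P]_w transport_cost p a mu (empirical_measure X N w) <=
    (2 * (tail_factor p a b M * E) + 2 * scale_const d p a *
     (\sum_(n < M.+1) ring_weight p a n * ring_mass d M L mu n `^ (1 - th)) *
     ((2 `^ p) ^- L + \sum_(i < L.+1) (2 `^ p) ^+ i.+1 / (2 `^ p) ^+ L *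
        (((2 ^ (L - i)).+1 ^ d)%:R / N%:R) `^ th))%:E)%E.
Proof.
move=> th0 th2; set W := \sum_(n < M.+1) _.
have th1 : 0 <= 1 - th by lra.
have C0 : 0 <= scale_const d p a by exact: le_trans ler01 (scale_const_ge1 d p a a0).
have w0 n : 0 <= ring_weight p a n by exact: ring_weight_ge0.
have rho0 : 0 < 2 `^ p :> R by exact: lt_trans ltr01 (powR2_gt1 p p0).
have rL0 : 0 <= (2 `^ p) ^- L :> R by rewrite invr_ge0 exprn_ge0 ?ltW.
apply: le_trans expected_cost_le_levels _.
rewrite [leRHS]EFinD [leRHS]addeC leeD2r// mulrDr EFinD; apply: leeD.
  rewrite lee_fin -2!mulrA; apply: ler_wpM2l => //.
  have -> : \sum_(s : S) scale_cost d p a M L 0 s * cell_prob q mu s =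
      \sum_(n < M.+1) (scale_const d p a * ring_weight p a n * (2 `^ p) ^- L) *
         ring_mass d M L mu n.
    rewrite (partition_big (fun k : S => k.1) predT)//=.
    apply: eq_bigr => n _; rewrite /ring_mass mulr_sumr.
    by apply: eq_bigr => k /eqP <-; rewrite /scale_cost expr0 mul1r.
  rewrite /W mulr_suml mulr_sumr; apply: ler_sum => n _.
  (* Masses are at most 1, so the finest-scale term is bounded by the same sum [W] as the
     deviations. *)
  have tle : ring_mass d M L mu n <= ring_mass d M L mu n `^ (1 - th).
    have [->|tn0] := eqVneq (ring_mass d M L mu n) 0; first exact: powR_ge0.
    have tp : 0 < ring_mass d M L mu n by rewrite lt_neqAle eq_sym tn0 ring_mass_ge0.
    by apply: ger1_powR; [rewrite tp ring_mass_le1|lra].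
  apply: (le_trans (ler_wpM2l (mulr_ge0 (mulr_ge0 C0 (w0 n)) rL0) tle)).
  by rewrite le_eqVlt; apply/orP; left; apply/eqP; ring.
apply: (@le_trans _ _ (\sum_(i < L.+1) (2 * scale_const d p a * W *
   ((2 `^ p) ^+ i.+1 / (2 `^ p) ^+ L * (((2 ^ (L - i)).+1 ^ d)%:R / N%:R) `^ th))%:E)%E).
  apply: lee_sum => i _.
  rewrite sum_scale_cost_ring; last by move=> k; exact: cell_deviation_ge0.
  set c := _ / _ ^+ L; set k := _ `^ th.
  have c0 : 0 <= c by rewrite divr_ge0// exprn_ge0// ltW.
  apply: (@le_trans _ _ (\sum_(n < M.+1) (scale_const d p a * ring_weight p a n * c *
      (2 * ring_mass d M L mu n `^ (1 - th) * k))%:E)%E).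
    apply: lee_sum => n _; rewrite [leRHS]EFinM; apply: lee_wpmul2l.
      by rewrite lee_fin; exact: (mulr_ge0 (mulr_ge0 C0 (w0 n)) c0).
    by apply: ring_deviation_le => //; rewrite -ltnS.
  rewrite sumEFin lee_fin /W mulr_sumr mulr_suml; apply: ler_sum => n _.
  by rewrite le_eqVlt; apply/orP; left; apply/eqP; ring.
by rewrite sumEFin lee_fin -mulr_sumr.
Qed.

End expected_cost.

(** * Rates *)

Lemma exists_tail_factor_le {R : realType} (p a b x : R) :
  0 < p -> 2 * a < b -> 0 < x ->
  exists2 M : nat, (0 < M)%N & tail_factor p a b M <= x.
Proof.
move=> p0 ab x0; have rho1 := powR2_gt1 p p0.
(* Linear growth of the heights is enough to make the tail factor arbitrarily small. *)
have bernoulli n : n%:R * (2 `^ p - 1) <= ring_height p n :> R.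
  elim: n => [|n IHn]; first by rewrite mul0r exprn_ge0 ?powR_ge0.
  have := ring_height_ge1 p p0 n.
  rewrite /ring_height exprS -natr1 in IHn * => h.
  have : 0 <= (2 `^ p - 1) * ((2 `^ p) ^+ n - 1).
    by rewrite mulr_ge0// subr_ge0// ltW.
  by lra.
pose c := (b - 2 * a) * (2 `^ p - 1).
have c0 : 0 < c by rewrite mulr_gt0// subr_gt0.
pose n := (Num.truncn (- ln x / c)).+1.
exists n.+1 => //; rewrite /tail_factor /= -[leRHS](@lnK R x) ?posrE// ler_expR.
have : - ln x / c < n%:R by exact: truncnS_gt.
rewrite ltr_pdivrMr// => /ltW h.
rewrite lerNl (le_trans h)// /c mulrCA; apply: ler_wpM2l; first by rewrite subr_ge0 ltW.
exact: bernoulli.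
Qed.

(* The three error terms are the tail, the diameter of the finest cells and the
   accumulated fluctuations of the cell masses over the scales. *)
Definition scale_error {R : realType} (d : nat) (p th : R) (N L : nat) : R :=
  N%:R^-1 + (2 `^ p) ^- L +
  N%:R `^ (- th) * \sum_(j < L.+1) (2 `^ (d%:R * th) / 2 `^ p) ^+ j.

Lemma expected_cost_le_scale_error {R : realType} (d : nat) (p a b E th : R) :
  (0 < d)%N -> 0 < a -> 0 < p -> p < 1 -> 2 * a < b -> 0 <= th -> th <= 2^-1 ->
  0 < b * (1 - th) / 2 `^ p - 2 * a ->
  exists2 C : R, 0 < C &
    forall (mu : probability (borelRd R d) R),
      (\int[mu]_y (expR (b * enorm y `^ p))%:E = E%:E)%E ->
      forall (disp : measure_display) (Omega : measurableType disp)
        (P : probability Omega R) (X : nat -> {RV P >-> borelRd R d}),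
        iid_with_law X mu ->
        forall N L : nat, (1 <= N)%N ->
          (\int[P]_w transport_cost p a mu (empirical_measure X N w)
             <= (C * scale_error d p th N L)%:E)%E.
Proof.
move=> d0 a0 p0 p1 ab th0 th2 c0.
have b0 : 0 < b by rewrite (lt_trans _ ab)// mulr_gt0.
pose W := (`|E| * expR b) `^ (1 - th) * (4 / (b * (1 - th) / 2 `^ p - 2 * a) ^+ 2) *
  (1 - (2 `^ p)^-1)^-1.
have rho1 := powR2_gt1 p p0.
have rho0 : 0 < 2 `^ p :> R by exact: lt_trans ltr01 rho1.
have s0 : 0 < 2 `^ (d%:R * th) :> R by rewrite powR_gt0.
have C00 : 0 <= scale_const d p a by exact: le_trans ler01 (scale_const_ge1 d p a a0).
have W0 : 0 <= W.
  apply: mulr_ge0; first by rewrite mulr_ge0 ?powR_ge0// divr_ge0 ?exprn_ge0// ltW.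
  by rewrite invr_ge0 subr_ge0 ltW// invf_lt1.
(* The constant is fixed before [mu], for an arbitrary real E; the absolute value keeps it positive.
   Once [mu] is given, E >= 1. *)
pose C := 1 + 2 * `|E| + 2 * scale_const d p a * W * (1 + 2 `^ p * 2 `^ (d%:R * th)).
have C1 : 0 <= 2 * scale_const d p a * W by rewrite mulr_ge0// mulr_ge0.
have C2 : 0 <= 2 `^ p * 2 `^ (d%:R * th) :> R by rewrite mulr_ge0// ltW.
exists C.
  rewrite /C -addrA; apply: (lt_le_trans ltr01); rewrite lerDl.
  by apply: addr_ge0; [rewrite mulr_ge0|rewrite (mulr_ge0 C1)// addr_ge0].
move=> mu muE disp Omega P X iidX N L N1.
have NR : 0 < N%:R :> R by rewrite ltr0n.
(* The cutoff depends on [N], so that the tail costs O(1/N). *)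
have [M M0 tM] := @exists_tail_factor_le R p a b N%:R^-1 p0 ab (etrans (invr_gt0 _) NR).
have E1 := exp_moment_ge1 d p b E mu b0 muE.
have E0 : 0 <= E by exact: le_trans ler01 E1.
apply: le_trans (expected_cost_le_rings d p a b E M L N X mu d0 a0 p0 p1 ab M0 N1 muE iidX
  th th0 th2) _.
rewrite lee_fin; set V := \sum_(n < M.+1) _.
have VW : V <= W.
  apply: (sum_ring_weight_le p a b (`|E| * expR b) th) => //.
  - by lra.
  - by move=> n; exact: ring_mass_ge0.
  - by move=> n; rewrite (ger0_norm E0); exact: (ring_mass_tail d p b E M L mu p0 b0 muE).
have rL0 : 0 <= (2 `^ p) ^- L :> R by rewrite invr_ge0 exprn_ge0// ltW.
set G := \sum_(j < L.+1) (2 `^ (d%:R * th) / 2 `^ p) ^+ j.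
have G0 : 0 <= G by apply: sumr_ge0 => j _; rewrite exprn_ge0// divr_ge0// ltW.
have NG0 : 0 <= N%:R `^ (- th) * G by rewrite mulr_ge0 ?powR_ge0.
(* Reindex by j = L - i and bound the number of cells by (2^j + 1)^d <= 2^(d (j+1)); this gives the
   ratio 2^(d th - p) and the extra factor 2^p 2^(d th). *)
have levels : \sum_(i < L.+1) (2 `^ p) ^+ i.+1 / (2 `^ p) ^+ L *
        (((2 ^ (L - i)).+1 ^ d)%:R / N%:R) `^ th <=
    2 `^ p * 2 `^ (d%:R * th) * (N%:R `^ (- th) * G).
  rewrite /G (reindex_inj rev_ord_inj)/= mulrA mulr_sumr; apply: ler_sum => i _.
  rewrite subSS; have iL : (i <= L)%N by rewrite -ltnS.
  rewrite subKn//.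
  have h1 : (((2 ^ i).+1 ^ d)%:R / N%:R) `^ th <=
      (2 `^ (d%:R * th)) ^+ i.+1 * N%:R `^ (- th).
    rewrite powRM ?invr_ge0//.
    have -> : (N%:R^-1) `^ th = N%:R `^ (- th) :> R.
      by rewrite -(powR_inv1 (ltW NR)) -powRrM mulN1r.
    apply: ler_wpM2r; first exact: powR_ge0.
    have -> : (2 `^ (d%:R * th)) ^+ i.+1 = ((2 ^ i.+1) ^ d)%:R `^ th :> R.
      by rewrite powRrM powR_mulrn// -!powR_exprn// -exprM mulnC -expnM natrX.
    apply: ge0_ler_powR; rewrite ?nnegrE// ler_nat leq_exp2r//.
    by rewrite expnS mul2n -addnn -addn1 leq_add2l expn_gt0.
  apply: le_trans (ler_wpM2l _ h1) _; first by rewrite divr_ge0// exprn_ge0// ltW.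
  rewrite le_eqVlt; apply/orP; left; apply/eqP.
  rewrite exprS expr_div_n.
  have -> : (2 `^ p) ^+ L = (2 `^ p) ^+ (L - i) * (2 `^ p) ^+ i :> R.
    by rewrite -exprD subnK.
  by rewrite !exprS; field; rewrite !expf_neq0// gt_eqF.
rewrite /scale_error -/G.
have h0 : tail_factor p a b M * E <= N%:R^-1 * E by apply: ler_wpM2r.
set x := N%:R^-1 in h0 *; set y := (2 `^ p) ^- L in rL0 *.
set z := N%:R `^ (- th) * G in NG0 levels *.
have x0 : 0 <= x by rewrite invr_ge0 ltW.
set Q := \sum_(i < L.+1) _ in levels *.
set k := 2 `^ p * _ in C2 levels *.
have yQ : 0 <= y + Q.
  apply: addr_ge0 => //; apply: sumr_ge0 => i _.
  by rewrite mulr_ge0 ?divr_ge0 ?exprn_ge0 ?powR_ge0.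
apply: (@le_trans _ _ (2 * (x * E) + 2 * scale_const d p a * W * (y + k * z))).
  apply: lerD; first by rewrite ler_wpM2l.
  apply: ler_pM => //.
  - by rewrite mulr_ge0 ?mulr_ge0// sumr_ge0// => n _; rewrite mulr_ge0 ?powR_ge0// ring_weight_ge0.
  - by apply: ler_wpM2l => //; rewrite mulr_ge0.
  - by rewrite lerD2l.
rewrite /C (ger0_norm E0); set c1 := 2 * scale_const d p a * W in C1 *.
have -> : (1 + 2 * E + c1 * (1 + k)) * (x + y + z) =
  2 * (x * E) + c1 * (y + k * z) +
   ((x + y + z) + 2 * E * (y + z) + c1 * (x + z) + c1 * k * (x + y)) by ring.
rewrite lerDl; move: C1 C2 x0 rL0 NG0; clearbody c1 k x y z => C1 C2 x0 rL0 NG0.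
by do ?[apply: addr_ge0 | apply: mulr_ge0].
Qed.

(** * Choice of the finest scale *)

Section optimal_level.
Context {R : realType} (d : nat) (p th : R) (N : nat).
Hypotheses (d0 : (0 < d)%N) (p0 : 0 < p) (th0 : 0 <= th) (N0 : (0 < N)%N).

Definition optimal_level : nat := up_log (2 ^ d) N.
Local Notation L := optimal_level.
Local Notation s := (2 `^ (d%:R * th) : R).

Let d2 : (1 < 2 ^ d)%N. Proof. by rewrite -[1%N](expn0 2) ltn_exp2l. Qed.
Let dR : 0 < d%:R :> R. Proof. by rewrite ltr0n. Qed.
Let NR : 0 < N%:R :> R. Proof. by rewrite ltr0n. Qed.
Let N1 : 1 <= N%:R :> R. Proof. by rewrite ler1n. Qed.

Lemma optimal_level_ge : N%:R <= (2 ^+ d) ^+ L :> R.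
Proof. by rewrite -natrX -natrX ler_nat up_logP. Qed.

Lemma optimal_level_le : (2 ^+ d) ^+ L <= 2 ^+ d * N%:R :> R.
Proof.
rewrite -!natrX -natrM ler_nat /L; move: N0; rewrite leq_eqVlt => /orP[/eqP <-|N2].
  by rewrite up_log1 expn0 muln1 expn_gt0.
have /andP[h _] := up_log_bounds d2 N2.
have L0 : (0 < up_log (2 ^ d) N)%N by rewrite up_log_gt0 d2.
by rewrite -(prednK L0) expnS leq_mul2l ltnW ?orbT.
Qed.

Let rhoE : 2 `^ p = (2 ^+ d) `^ (p / d%:R) :> R.
Proof. by rewrite -powR_mulrn// -powRrM mulrCA divff ?mulr1// gt_eqF. Qed.

Lemma finest_scale_le : (2 `^ p) ^- L <= N%:R `^ (- (p / d%:R)).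
Proof.
rewrite powRN lef_pV2 ?posrE ?powR_gt0 ?exprn_gt0 ?powR_gt0//.
rewrite rhoE -powR_exprn ?exprn_ge0//; apply: ge0_ler_powR.
- by apply: divr_ge0; exact: ltW.
- by rewrite nnegrE.
- by rewrite nnegrE exprn_ge0// exprn_ge0.
- exact: optimal_level_ge.
Qed.

Let invN_le e : e <= 1 -> N%:R^-1 <= N%:R `^ (- e) :> R.
Proof.
by move=> e1; rewrite -(powR_inv1 (ltW NR)); apply: ler_powR => //; rewrite lerN2.
Qed.

Let ratioE : s / 2 `^ p = 2 `^ (d%:R * th - p).
Proof. by rewrite powRB// pnatr_eq0 implybT. Qed.

(** The ratio 2^(d th - p) is below 1: the coarse scales dominate and the sum stays bounded. *)
Lemma scale_error_subcritical : th <= 1 -> th < p / d%:R ->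
  scale_error d p th N L <= (2 + (1 - 2 `^ (d%:R * th - p))^-1) * N%:R `^ (- th).
Proof.
move=> th1 thp; rewrite /scale_error mulrDl; apply: lerD.
  rewrite mulrDl mul1r; apply: lerD; first exact: invN_le.
  by apply: le_trans finest_scale_le _; apply: ler_powR => //; rewrite lerN2 ltW.
rewrite [leRHS]mulrC; apply: ler_wpM2l; first exact: powR_ge0.
rewrite ratioE; apply: sum_geometric_lt1; first exact: powR_ge0.
have e0 : 0 < p - d%:R * th by rewrite subr_gt0 mulrC -ltr_pdivlMr.
by rewrite -opprB powRN invf_lt1 ?powR_gt0// powR2_gt1.
Qed.

(** The ratio exceeds 1: the finest scale dominates, and 2^(d th L) <= 2^(d th) N^th cancels
    N^(-th), leaving 2^(-p L). *)
Lemma scale_error_supercritical : p <= d%:R -> p / d%:R < th ->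
  scale_error d p th N L <= (2 + 2 `^ (d%:R * th) *
    (2 `^ (d%:R * th - p) / (2 `^ (d%:R * th - p) - 1))) * N%:R `^ (- (p / d%:R)).
Proof.
move=> pd thp; rewrite /scale_error mulrDl; apply: lerD.
  rewrite mulrDl mul1r; apply: lerD; last exact: finest_scale_le.
  by apply: invN_le; rewrite ler_pdivrMr// mul1r.
set g := 2 `^ (d%:R * th - p).
have g1 : 1 < g by apply: powR2_gt1; rewrite subr_gt0 mulrC -ltr_pdivrMr.
have g10 : 0 < g - 1 by rewrite subr_gt0.
rewrite ratioE -/g; apply: (@le_trans _ _ (N%:R `^ (- th) * (g ^+ L.+1 / (g - 1)))).
  by apply: ler_wpM2l; [exact: powR_ge0|exact: sum_geometric_gt1].
have sL : s ^+ L <= s * N%:R `^ th.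
  have sE : s = (2 ^+ d) `^ th by rewrite powRrM powR_mulrn.
  rewrite sE -powR_exprn ?exprn_ge0// -powRM ?exprn_ge0//.
  apply: ge0_ler_powR => //; rewrite ?nnegrE ?exprn_ge0 ?mulr_ge0 ?exprn_ge0//.
  exact: optimal_level_le.
have gL : N%:R `^ (- th) * g ^+ L <= s * N%:R `^ (- (p / d%:R)).
  rewrite /g -ratioE expr_div_n mulrA.
  apply: ler_pM; [| | |exact: finest_scale_le].
  - by rewrite mulr_ge0 ?powR_ge0 ?exprn_ge0 ?powR_ge0.
  - by rewrite invr_ge0 exprn_ge0 ?powR_ge0.
  apply: le_trans (ler_wpM2l (powR_ge0 _ _) sL) _.
  by rewrite mulrCA -powRD ?addNr ?powRr0 ?mulr1// (gt_eqF NR) implybT.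
have -> : N%:R `^ (- th) * (g ^+ L.+1 / (g - 1)) =
    N%:R `^ (- th) * g ^+ L * (g / (g - 1)) by rewrite exprS; ring.
rewrite [leRHS]mulrAC; apply: ler_wpM2r => //.
by rewrite divr_ge0 ?ltW// (lt_trans ltr01).
Qed.

(** The ratio is 1, so the L + 1 scales contribute equally and the total is at most (L + 3) N^(-th).
    The constant 5 comes from L ln 2 <= ln 2 + ln N, since both ln 2 and ln N are at most ln (N +
    1). *)
Lemma scale_error_critical : th <= 1 -> th = p / d%:R ->
  scale_error d p th N L <= 5 / ln 2 * (ln (N%:R + 1) * N%:R `^ (- th)).
Proof.
move=> th1 thp; have ln2 : 0 < ln 2 :> R by rewrite ln_gt0// ltr1n.
have e : d%:R * th - p = 0 by rewrite thp mulrCA divff ?mulr1 ?subrr// gt_eqF.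
rewrite /scale_error ratioE e powRr0.
under eq_bigr do rewrite expr1n.
rewrite sumr_const card_ord.
apply: (@le_trans _ _ ((L%:R + 3) * N%:R `^ (- th))).
  have h1 : N%:R^-1 <= N%:R `^ (- th) by exact: invN_le.
  have h2 : (2 `^ p) ^- L <= N%:R `^ (- th) by rewrite thp; exact: finest_scale_le.
  by rewrite -natr1; lra.
rewrite mulrA; apply: ler_wpM2r; first exact: powR_ge0.
rewrite mulrAC ler_pdivlMr//.
have lnN : ln N%:R <= ln (N%:R + 1) :> R.
  by rewrite ler_ln ?posrE ?addr_gt0// lerDl.
have ln2N : ln 2 <= ln (N%:R + 1) :> R.
  by rewrite ler_ln ?posrE ?addr_gt0//; have := N1; lra.
have lnL : L%:R * ln 2 <= ln 2 + ln N%:R :> R.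
  have h : ln ((2 ^+ d) ^+ L) <= ln (2 ^+ d * N%:R) :> R.
    by rewrite ler_ln ?posrE ?mulr_gt0 ?exprn_gt0// optimal_level_le.
  rewrite lnM ?posrE ?exprn_gt0// !lnXn ?exprn_gt0// in h.
  rewrite -(ler_pM2l dR); apply: (@le_trans _ _ (ln 2 *+ d *+ L)).
    by rewrite -[leRHS]mulr_natl -[ln 2 *+ d]mulr_natl mulrCA.
  rewrite (le_trans h)// -[ln 2 *+ d]mulr_natl mulrDr lerD2l ler_peMl ?ln_ge0//.
  by rewrite ler1n.
by lra.
Qed.

End optimal_level.

Theorem mainTheorem5 (R : realType) (d : nat) (a p b E : R)
    (hd : (1 <= d)%N) (ha : 0 < a) (hp0 : 0 < p) (hp1 : p < 1)
    (hb : 2 `^ (p + 1) * a < b) :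
  ((d%:R / 2 <= p -> 2 `^ (p + 2) * a < b) ->
   (p < d%:R / 2 -> 2 `^ (p + 1) * d%:R * a / (d%:R - p) < b) ->
   exists2 C : R, 0 < C &
     forall (mu : probability (borelRd R d) R),
       (\int[mu]_y (expR (b * enorm y `^ p))%:E = E%:E)%E ->
       forall (disp : measure_display) (Omega : measurableType disp)
         (P : probability Omega R) (X : nat -> {RV P >-> borelRd R d}),
         iid_with_law X mu ->
         forall N : nat, (1 <= N)%N ->
           (\int[P]_w transport_cost p a mu (empirical_measure X N w)
              <= (C * rate d p N)%:E)%E)
  /\
  ((d%:R / 2 <= p -> b <= 2 `^ (p + 2) * a) ->
   (p < d%:R / 2 -> b <= 2 `^ (p + 1) * d%:R * a / (d%:R - p)) ->
   forall eps : R, 0 < eps -> eps < 1 - 2 `^ (p + 1) * a / b ->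
   exists2 C : R, 0 < C &
     forall (mu : probability (borelRd R d) R),
       (\int[mu]_y (expR (b * enorm y `^ p))%:E = E%:E)%E ->
       forall (disp : measure_display) (Omega : measurableType disp)
         (P : probability Omega R) (X : nat -> {RV P >-> borelRd R d}),
         iid_with_law X mu ->
         forall N : nat, (1 <= N)%N ->
           (\int[P]_w transport_cost p a mu (empirical_measure X N w)
              <= (C * N%:R `^ (- (1 - 2 `^ (p + 1) * a / b - eps)))%:E)%E).
Proof.
have rho1 := powR2_gt1 p hp0.
have rho0 : 0 < 2 `^ p :> R by exact: lt_trans ltr01 rho1.
have E1 : 2 `^ (p + 1) = 2 * 2 `^ p :> R.
  by rewrite powRD ?pnatr_eq0 ?implybT// powRr1// mulrC.
have E2 : 2 `^ (p + 2) = 4 * 2 `^ p :> R.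
  by rewrite powRD ?pnatr_eq0 ?implybT// powR_mulrn// mulrC expr2 -natrM.
rewrite E1 E2 in hb *.
have dR : 1 <= d%:R :> R by rewrite ler1n.
have d0 : 0 < d%:R :> R by rewrite (lt_le_trans ltr01).
have dp : 0 < d%:R - p by rewrite subr_gt0 (lt_le_trans hp1).
pose q := 2 * 2 `^ p * a; rewrite -/q in hb *.
have q0 : 0 < q by rewrite !mulr_gt0.
have b0 : 0 < b by exact: lt_trans q0 hb.
have ab : 2 * a < b.
  by apply: le_lt_trans hb; rewrite /q -mulrA ler_pM2l// ler_peMl ?ltW.
(* The condition for summability over the annuli, with q = 2^(p+1) a. *)
have gap th : th < 1 - q / b -> 0 < b * (1 - th) / 2 `^ p - 2 * a.
  rewrite ltrBrDr addrC -ltrBrDr ltr_pdivrMr// => h.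
  by rewrite subr_gt0 ltr_pdivlMr// mulrAC [b * _]mulrC.
have q_half : 4 * 2 `^ p * a = 2 * q by rewrite /q; ring.
have q_crit : 2 * 2 `^ p * d%:R * a = q * d%:R by rewrite /q; ring.
rewrite q_half q_crit.
have crit : p / d%:R = 1 - (d%:R - p) / d%:R by field; rewrite gt_eqF.
have pd_half : (p / d%:R < 2^-1) = (p < d%:R / 2) by rewrite ltr_pdivrMr// mulrC.
have half_pd : (2^-1 < p / d%:R) = (d%:R / 2 < p) by rewrite ltr_pdivlMr// mulrC.
have reduce th (r : nat -> R) (K : R) : 0 <= th -> th <= 2^-1 -> th < 1 - q / b ->
    (forall N, 0 <= r N) ->
    (forall N, (0 < N)%N -> scale_error d p th N (optimal_level d N) <= K * r N) ->
    exists2 C : R, 0 < C & forall (mu : probability (borelRd R d) R),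
       (\int[mu]_y (expR (b * enorm y `^ p))%:E = E%:E)%E ->
       forall (disp : measure_display) (Omega : measurableType disp)
         (P : probability Omega R) (X : nat -> {RV P >-> borelRd R d}),
         iid_with_law X mu ->
         forall N : nat, (1 <= N)%N ->
           (\int[P]_w transport_cost p a mu (empirical_measure X N w)
              <= (C * r N)%:E)%E.
  move=> th0 th2 thq r0 Kr.
  have [C C0 CP] := expected_cost_le_scale_error d p a b E th hd ha hp0 hp1 ab th0 th2 (gap _ thq).
  exists (C * (`|K| + 1)); first by rewrite mulr_gt0// ltr_wpDl.
  move=> mu muE disp Omega P X iidX N N0.
  apply: le_trans (CP mu muE disp Omega P X iidX N (optimal_level d N) N0) _.
  rewrite lee_fin -mulrA ler_pM2l// (le_trans (Kr N N0))//.
  by apply: ler_wpM2r => //; rewrite (le_trans (ler_norm K))// lerDl.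
split.
- move=> hge hlt.
  have [pd|dp2] := ltP p (d%:R / 2).
    have rE N : rate d p N = N%:R `^ (- (p / d%:R)).
      by rewrite /rate ltNge (ltW pd)/= lt_eqF.
    have pq : p / d%:R < 1 - q / b.
      have := hlt pd; rewrite ltr_pdivrMr// => h.
      by rewrite crit ltrD2l ltrN2 ltr_pdivrMr// mulrAC ltr_pdivlMr// [_ * b]mulrC.
    have pm : p / d%:R < Num.min 2^-1 (1 - q / b) by rewrite lt_min pd_half pd.
    (* Strictly above p/d, so that the geometric sum over scales brings no logarithm; the lower
       bound on b leaves this room. *)
    pose th := (p / d%:R + Num.min 2^-1 (1 - q / b)) / 2.
    have th1 : p / d%:R < th by rewrite /th; lra.
    have : th < Num.min 2^-1 (1 - q / b) by rewrite /th; lra.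
    rewrite lt_min => /andP[th2 th3].
    have th0 : 0 <= th by rewrite (le_trans _ (ltW th1))// divr_ge0 ?ltW.
    apply: (reduce th _ _ th0 (ltW th2) th3) => N; first by rewrite rE powR_ge0.
    move=> N0; rewrite rE; apply: scale_error_supercritical => //.
    exact: le_trans (ltW hp1) dR.
  (* b > 2 q is precisely the admissibility of th = 1/2, used for p > d/2 and at the critical p =
     d/2. *)
  have hq : 2^-1 < 1 - q / b.
    by have := hge dp2; rewrite ltrBrDr addrC -ltrBrDr ltr_pdivrMr//; lra.
  have [pd|pd] := ltP (d%:R / 2) p.
    apply: (reduce 2^-1 _ _ _ (lexx _) hq) => // N.
      by rewrite /rate pd powR_ge0.
    move=> N0; rewrite /rate pd; apply: scale_error_subcritical => //; last by rewrite half_pd.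
    by lra.
  have pE : p = d%:R / 2 by apply/le_anti; rewrite pd dp2.
  have rE N : rate d p N = ln (N%:R + 1) * N%:R `^ (- 2^-1).
    by rewrite /rate ltNge pd/= pE eqxx.
  apply: (reduce 2^-1 _ _ _ (lexx _) hq) => // N.
    by rewrite rE mulr_ge0 ?powR_ge0// ln_ge0// lerDr.
  move=> N0; rewrite rE; apply: scale_error_critical => //; first by lra.
  by rewrite pE mulrAC divff ?mul1r// gt_eqF.
- move=> hge hlt eps eps0 epsq.
  pose th := 1 - q / b - eps.
  have th0 : 0 <= th by rewrite /th subr_ge0 ltW.
  have thq : th < 1 - q / b by rewrite /th gtrBl.
  (* The upper bounds on b give 1 - q / b <= p/d, respectively <= 1/2; subtracting eps makes [th]
     strictly subcritical, so no logarithm appears. *)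
  have [th2 thp] : th <= 2^-1 /\ th < p / d%:R.
    have [pd|dp2] := ltP p (d%:R / 2).
      have qp : 1 - q / b <= p / d%:R.
        have := hlt pd; rewrite ler_pdivlMr// => h.
        by rewrite crit lerD2l lerN2 ler_pdivrMr// mulrAC ler_pdivlMr// [_ * b]mulrC.
      have thp := lt_le_trans thq qp.
      by split => //; rewrite ltW// (lt_trans thp)// pd_half.
    have hq : 1 - q / b <= 2^-1.
      by have := hge dp2; rewrite lerBlDr addrC -lerBlDr ler_pdivlMr//; lra.
    have th2 := lt_le_trans thq hq.
    by split; [exact: ltW|rewrite (lt_le_trans th2)// leNgt pd_half -leNgt].
  apply: (reduce th (fun N => N%:R `^ (- th)) _ th0 th2 thq) => N.
    exact: powR_ge0.
  by move=> N0; apply: scale_error_subcritical => //; lra.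
Qed.
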